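(* For a Turing degree $\mathbf d$ the following are equivalent: (1) $\mathbf d$ enumerates all $\Sigma^1_1$ sets (every $\Sigma^1_1$ subset of $\omega$ is c.e. in $\mathbf d$); (2) $\mathbf d$ is uniformly high for paths in the reticent sense; (3) $\mathbf d$ is uniformly high for isomorphism in the reticent sense; (4) $\mathbf d$ is uniformly high for descending sequences in the reticent sense; (5) $\mathbf d$ is uniformly high for tight descending sequences; (6) $\mathbf d$ is uniformly high for tight descending sequences in the reticent sense.
   Context: Let $(\mathcal P_e)_{e\in\omega}$ be an effective listing of the $\Pi^0_1$ classes in $\omega^\omega$, $(\mathcal M_i)_{i\in\omega}$ an effective listing of all computable structures, and $(\mathcal L_e)_{e\in\omega}$ an effective listing of the computable linear orders. For a linear order $\mathcal L$, a tight descending sequence is an infinite descending sequence $f$ such that for every descending sequence $g$ in $\mathcal L$ and every $n$ there is $m$ with $f(m)<_{\mathcal L}g(n)$. Each notion below is witnessed by some $D\in\mathbf d$ and a total computable function $f$: uniformly high for paths means $\{f(e)\}^D\in\mathcal P_e$ whenever $\mathcal P_e\ne\emptyset$; uniformly high for isomorphism means $\{f(i,j)\}^D$ is an isomorphism from $\mathcal M_i$ to $\mathcal M_j$ whenever $\mathcal M_i\cong\mathcal M_j$; uniformly high for (tight) descending sequences means $\{f(e)\}^D$ is a (tight) infinite descending sequence in $\mathcal L_e$ whenever $\mathcal L_e$ is ill-founded. Such a notion holds in the reticent sense if moreover $f$ can be chosen so that for every index outside the relevant set (i.e. $\mathcal P_e=\emptyset$; resp. $\mathcal M_i\not\cong\mathcal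 M_j$; resp. $\mathcal L_e$ well-founded), the partial function $\{f(\cdot)\}^D$ at that index diverges on every input. *)

(* Defs.v *)
From Stdlib Require Import Arith Lia List.
From Stdlib Require Cantor.

Notation "⟨ x , y ⟩" := (Cantor.to_nat (x, y)) (at level 0, x at level 200, y at level 200).

(** * Oracle computation *)

(** Codes for the unary partial functions recursive in an oracle; several
    arguments are passed through Cantor's bijection.  The identity is
    [CPair CLeft CRight]. *)
Inductive code : Type :=
| CZero | CSucc | CLeft | CRight | COracle
| CPair (f g : code)
| CComp (f g : code)
| CPrec (f g : code)
| CMin (f : code).

(** [prec_graph F G n y]: y is the value at n of the function defined by
    primitive recursion from the initial value F and the step G. *)
Fixpoint prec_graph (F : nat -> Prop) (G : nat -> nat -> nat -> Prop)
    (n y : nat) : Prop :=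
  match n with
  | 0 => F y
  | S m => exists r, prec_graph F G m r /\ G m r y
  end.

(** [ev O c x y]: the program c with oracle O halts on x with output y. *)
Fixpoint ev (O : nat -> nat) (c : code) (x y : nat) : Prop :=
  match c with
  | CZero => y = 0
  | CSucc => y = S x
  | CLeft => y = fst (Cantor.of_nat x)
  | CRight => y = snd (Cantor.of_nat x)
  | COracle => y = O x
  | CPair f g => exists u v, ev O f x u /\ ev O g x v /\ y = ⟨u, v⟩
  | CComp f g => exists u, ev O g x u /\ ev O f u y
  | CPrec f g =>
      let a := fst (Cantor.of_nat x) in
      prec_graph (ev O f a) (fun m r => ev O g ⟨a, ⟨m, r⟩⟩)
        (snd (Cantor.of_nat x)) y
  | CMin f =>
      ev O f ⟨x, y⟩ 0 /\ forall m, m < y -> exists k, ev O f ⟨x, m⟩ (S k)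
  end.

Lemma ev_functional O c : forall x y y', ev O c x y -> ev O c x y' -> y = y'.
Proof.
  induction c as [| | | | |f IHf g IHg|f IHf g IHg|f IHf g IHg|f IHf];
    simpl; intros x y y' H H'; try congruence.
  - destruct H as (u & v & Hu & Hv & ->), H' as (u' & v' & Hu' & Hv' & ->).
    now rewrite (IHf _ _ _ Hu Hu'), (IHg _ _ _ Hv Hv').
  - destruct H as (u & Hu & Hy), H' as (u' & Hu' & Hy').
    rewrite (IHg _ _ _ Hu Hu') in Hy. eauto.
  - revert y y' H H'. generalize (snd (Cantor.of_nat x)) as n.
    induction n as [|n IHn]; simpl; intros y y' H H'; [eauto|].
    destruct H as (r & Hr & Hy), H' as (r' & Hr' & Hy').
    rewrite (IHn _ _ Hr Hr') in Hy. eauto.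
  - destruct H as [H0 H1], H' as [H0' H1'].
    destruct (Nat.lt_trichotomy y y') as [lt|[eq|lt]]; [|exact eq|].
    + destruct (H1' _ lt) as [k Hk]. discriminate (IHf _ _ _ H0 Hk).
    + destruct (H1 _ lt) as [k Hk]. discriminate (IHf _ _ _ H0' Hk).
Qed.

(** Goedel numbering: a bijection between [nat] and [code]. *)
Fixpoint decode_fuel (fuel n : nat) : code :=
  match fuel with
  | 0 => CZero
  | S fuel =>
      match n with
      | 0 => CZero
      | 1 => CSucc
      | 2 => CLeft
      | 3 => CRight
      | 4 => COracle
      | S (S (S (S (S m)))) =>
          let r := m / 4 in
          let a := fst (Cantor.of_nat r) in
          let b := snd (Cantor.of_nat r) in
          match m mod 4 with
          | 0 => CPair (decode_fuel fuel a) (decode_fuel fuel b)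
          | 1 => CComp (decode_fuel fuel a) (decode_fuel fuel b)
          | 2 => CPrec (decode_fuel fuel a) (decode_fuel fuel b)
          | _ => CMin (decode_fuel fuel r)
          end
      end
  end.

Definition decode (n : nat) : code := decode_fuel (S n) n.

Fixpoint encode (c : code) : nat :=
  match c with
  | CZero => 0
  | CSucc => 1
  | CLeft => 2
  | CRight => 3
  | COracle => 4
  | CPair f g => 5 + (⟨encode f, encode g⟩ * 4)
  | CComp f g => 5 + (1 + ⟨encode f, encode g⟩ * 4)
  | CPrec f g => 5 + (2 + ⟨encode f, encode g⟩ * 4)
  | CMin f => 5 + (3 + encode f * 4)
  end.

Lemma decodeK c : decode (encode c) = c.
Proof.
  unfold decode. generalize (Nat.lt_succ_diag_r (encode c)).
  generalize (S (encode c)) as k. intros k; revert k.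
  assert (D : forall t r, t < 4 -> (t + r * 4) / 4 = r).
  { intros t r Ht. rewrite Nat.div_add, Nat.div_small; lia. }
  assert (M : forall t r, t < 4 -> (t + r * 4) mod 4 = t).
  { intros t r Ht. rewrite Nat.Div0.mod_add, Nat.mod_small; lia. }
  assert (D0 : forall r, (r * 4) / 4 = r) by (intros; exact (D 0 r ltac:(lia))).
  assert (M0 : forall r, (r * 4) mod 4 = 0) by (intros; exact (M 0 r ltac:(lia))).
  assert (B : forall a b, a <= ⟨a, b⟩ /\ b <= ⟨a, b⟩).
  { intros a b. pose proof (Cantor.to_nat_non_decreasing a b). lia. }
  induction c as [| | | | |f IHf g IHg|f IHf g IHg|f IHf g IHg|f IHf];
    intros [|k] Hk; try lia; try reflexivity;
    cbn [encode] in Hk |- *; cbn -[Cantor.to_nat Cantor.of_nat Nat.div Nat.modulo Nat.mul Nat.add].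
  1-3: pose proof (B (encode f) (encode g)).
  - change (5 + ?x) with (S (S (S (S (S x))))).
    cbn -[Cantor.to_nat Cantor.of_nat Nat.div Nat.modulo Nat.mul Nat.add].
    rewrite D0, M0, Cantor.cancel_of_to; simpl fst; simpl snd.
    rewrite IHf, IHg; [reflexivity|lia|lia].
  - change (5 + ?x) with (S (S (S (S (S x))))).
    cbn -[Cantor.to_nat Cantor.of_nat Nat.div Nat.modulo Nat.mul Nat.add].
    rewrite D, M, Cantor.cancel_of_to by lia; simpl fst; simpl snd.
    rewrite IHf, IHg; [reflexivity|lia|lia].
  - change (5 + ?x) with (S (S (S (S (S x))))).
    cbn -[Cantor.to_nat Cantor.of_nat Nat.div Nat.modulo Nat.mul Nat.add].
    rewrite D, M, Cantor.cancel_of_to by lia; simpl fst; simpl snd.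
    rewrite IHf, IHg; [reflexivity|lia|lia].
  - change (5 + ?x) with (S (S (S (S (S x))))).
    cbn -[Cantor.to_nat Cantor.of_nat Nat.div Nat.modulo Nat.mul Nat.add].
    rewrite D, M by lia. rewrite IHf; [reflexivity|lia].
Qed.

(** [phi D e x y]: {e}^D(x) converges to y. *)
Definition phi (D : nat -> bool) (e x y : nat) : Prop :=
  ev (fun n => Nat.b2n (D n)) (decode e) x y.

Definition phi0 : nat -> nat -> nat -> Prop := phi (fun _ => false).

Definition computable_fun (f : nat -> nat) : Prop :=
  exists e, forall x, phi0 e x (f x).

Definition computable_fun2 (f : nat -> nat -> nat) : Prop :=
  exists e, forall x y, phi0 e ⟨x, y⟩ (f x y).

Definition ce_in (D : nat -> bool) (A : nat -> Prop) : Prop :=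
  exists e, forall n, A n <-> exists y, phi D e n y.

Definition turing_le (A B : nat -> bool) : Prop :=
  exists e, forall x, phi B e x (Nat.b2n (A x)).

Definition turing_degree (d : (nat -> bool) -> Prop) : Prop :=
  exists A, forall B, d B <-> turing_le A B /\ turing_le B A.

(** * Σ¹₁ sets and Π⁰₁ classes *)

(** Bijective coding of finite sequences. *)
Fixpoint seqcode (l : list nat) : nat :=
  match l with
  | nil => 0
  | x :: l => S ⟨x, seqcode l⟩
  end.

Definition initseg (X : nat -> nat) (m : nat) : list nat := map X (seq 0 m).

Definition Sigma11 (A : nat -> Prop) : Prop :=
  exists R : nat -> list nat -> bool,
    (exists e, forall n s, phi0 e ⟨n, seqcode s⟩ (Nat.b2n (R n s))) /\
    forall n, A n <-> exists X, forall m, R n (initseg X m) = true.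

(** The e-th Π⁰₁ class is the complement of the open set generated by the e-th
    c.e. set of strings. *)
Definition Pi01_class (e : nat) (X : nat -> nat) : Prop :=
  forall m, ~ exists y, phi0 e (seqcode (initseg X m)) y.

(** * Computable structures *)

(** A language assigns to each number either no symbol, or a relation or
    function symbol with its arity (constants are function symbols of arity 0). *)
Inductive symbol : Type := NoSym | RelSym (n : nat) | FunSym (n : nat).

Definition symcode (s : symbol) : nat :=
  match s with
  | NoSym => 0
  | RelSym n => 1 + 2 * n
  | FunSym n => 2 + 2 * n
  end.

Definition tuple_in (dom : nat -> bool) (n : nat) (a : list nat) : Prop :=
  length a = n /\ Forall (fun x => dom x = true) a.

(** Structures whose universe is a subset of ω.  The values of [rel] and [fn]
    are meaningful only on tuples of the right length from the universe. *)
Record structure : Type := Structure {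
  lang : nat -> symbol;
  dom : nat -> bool;
  rel : nat -> list nat -> bool;
  fn : nat -> list nat -> nat;
  dom_nonempty : exists x, dom x = true;
  fn_closed : forall k n a,
    lang k = FunSym n -> tuple_in dom n a -> dom (fn k a) = true
}.

(** M is the i-th computable structure: {i} computes its language, its universe
    and its atomic diagram.  Numbers i for which {i} is not of this kind name
    no structure. *)
Definition names_structure (i : nat) (M : structure) : Prop :=
  (forall k, phi0 i ⟨0, k⟩ (symcode (lang M k))) /\
  (forall x, phi0 i ⟨1, x⟩ (Nat.b2n (dom M x))) /\
  (forall k n a, lang M k = RelSym n -> tuple_in (dom M) n a ->
     phi0 i ⟨2, ⟨k, seqcode a⟩⟩ (Nat.b2n (rel M k a))) /\
  (forall k n a, lang M k = FunSym n -> tuple_in (dom M) n a ->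
     phi0 i ⟨2, ⟨k, seqcode a⟩⟩ (fn M k a)).

(** F is the graph of an isomorphism from M to N. *)
Record isomorphism (M N : structure) (F : nat -> nat -> Prop) : Prop := {
  iso_lang : forall k, lang M k = lang N k;
  iso_dom : forall x y, F x y -> dom M x = true /\ dom N y = true;
  iso_total : forall x, dom M x = true -> exists y, F x y;
  iso_functional : forall x y y', F x y -> F x y' -> y = y';
  iso_injective : forall x x' y, F x y -> F x' y -> x = x';
  iso_surjective : forall y, dom N y = true -> exists x, F x y;
  iso_rel : forall k n a b, lang M k = RelSym n -> length a = n ->
    Forall2 F a b -> rel M k a = rel N k b;
  iso_fn : forall k n a b, lang M k = FunSym n -> length a = n ->
    Forall2 F a b -> F (fn M k a) (fn N k b)
}.

Definition isomorphic (M N : structure) : Prop := exists F, isomorphism M N F.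

(** * Computable linear orders *)

Record linear_order : Type := LinearOrder {
  ldom : nat -> bool;
  llt : nat -> nat -> bool;
  llt_irrefl : forall x, ldom x = true -> llt x x = false;
  llt_trans : forall x y z, ldom x = true -> ldom y = true -> ldom z = true ->
    llt x y = true -> llt y z = true -> llt x z = true;
  llt_total : forall x y, ldom x = true -> ldom y = true ->
    llt x y = true \/ x = y \/ llt y x = true
}.

(** L is the e-th computable linear order; as for structures, some e name none. *)
Definition names_order (e : nat) (L : linear_order) : Prop :=
  (forall x, phi0 e ⟨0, x⟩ (Nat.b2n (ldom L x))) /\
  (forall x y, ldom L x = true -> ldom L y = true ->
     phi0 e ⟨1, ⟨x, y⟩⟩ (Nat.b2n (llt L x y))).

Definition descending (L : linear_order) (g : nat -> nat) : Prop :=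
  (forall n, ldom L (g n) = true) /\ (forall n, llt L (g (S n)) (g n) = true).

Definition tight_descending (L : linear_order) (g : nat -> nat) : Prop :=
  descending L g /\
  forall h, descending L h -> forall n, exists m, llt L (g m) (h n) = true.

Definition ill_founded (L : linear_order) : Prop := exists g, descending L g.

(** * Highness notions *)

Definition enumerates_all_Sigma11 (d : (nat -> bool) -> Prop) : Prop :=
  forall A, Sigma11 A -> exists D, d D /\ ce_in D A.

(** {e}^D is total and equal to X. *)
Definition computes (D : nat -> bool) (e : nat) (X : nat -> nat) : Prop :=
  forall n, phi D e n (X n).

Definition nowhere_defined (D : nat -> bool) (e : nat) : Prop :=
  forall n, ~ exists y, phi D e n y.

Definition finds_paths (D : nat -> bool) (f : nat -> nat) : Prop :=
  forall e, (exists X, Pi01_class e X) ->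
    exists X, computes D (f e) X /\ Pi01_class e X.

Definition finds_isomorphisms (D : nat -> bool) (f : nat -> nat -> nat) : Prop :=
  forall i j M N, names_structure i M -> names_structure j N ->
    isomorphic M N -> isomorphism M N (phi D (f i j)).

Definition finds_descending (D : nat -> bool) (f : nat -> nat) : Prop :=
  forall e L, names_order e L -> ill_founded L ->
    exists g, computes D (f e) g /\ descending L g.

Definition finds_tight_descending (D : nat -> bool) (f : nat -> nat) : Prop :=
  forall e L, names_order e L -> ill_founded L ->
    exists g, computes D (f e) g /\ tight_descending L g.

Definition reticent_paths (D : nat -> bool) (f : nat -> nat) : Prop :=
  forall e, ~ (exists X, Pi01_class e X) -> nowhere_defined D (f e).

Definition reticent_isomorphisms (D : nat -> bool) (f : nat -> nat -> nat) : Prop :=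
  forall i j,
    ~ (exists M N, names_structure i M /\ names_structure j N /\ isomorphic M N) ->
    nowhere_defined D (f i j).

Definition reticent_descending (D : nat -> bool) (f : nat -> nat) : Prop :=
  forall e, ~ (exists L, names_order e L /\ ill_founded L) ->
    nowhere_defined D (f e).

Definition unif_high_paths_reticent (d : (nat -> bool) -> Prop) : Prop :=
  exists D f, d D /\ computable_fun f /\ finds_paths D f /\ reticent_paths D f.

Definition unif_high_isomorphism_reticent (d : (nat -> bool) -> Prop) : Prop :=
  exists D f, d D /\ computable_fun2 f /\
    finds_isomorphisms D f /\ reticent_isomorphisms D f.

Definition unif_high_descending_reticent (d : (nat -> bool) -> Prop) : Prop :=
  exists D f, d D /\ computable_fun f /\
    finds_descending D f /\ reticent_descending D f.

Definition unif_high_tight_descending (d : (nat -> bool) -> Prop) : Prop :=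
  exists D f, d D /\ computable_fun f /\ finds_tight_descending D f.

Definition unif_high_tight_descending_reticent (d : (nat -> bool) -> Prop) : Prop :=
  exists D f, d D /\ computable_fun f /\
    finds_tight_descending D f /\ reticent_descending D f.

(* Main.v *)
Require Import Defs.
From Stdlib Require Import Arith Lia List Bool.
From Stdlib Require Import Classical ClassicalEpsilon FunctionalExtensionality PropExtensionality.
Import ListNotations.

(** Since running a program for finitely many steps is effective, every condition
    "some X satisfies a given Π⁰₂ predicate" has Σ¹₁ form.

    From an enumeration of all Σ¹₁ sets one computes a path through a nonempty
    Π⁰₁ class by searching for one-step extensions that are extendible to a
    path; nothing is ever found if the class is empty.  An isomorphism is read
    off a path of the class of codes for two structures with an isomorphism and
    its inverse.  The elements of a linear order which start a descending
    sequence form a Σ¹₁ set; a descending sequence of such elements that goes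
    below each enumerated one is tight.

    Conversely a Σ¹₁ set is a family of trees, and the question is which of them
    have a path.  Reticence makes convergence a Σ⁰₁ criterion for this, applied to
    the Π⁰₁ class of paths, to the Kleene-Brouwer order, or to a pair of
    structures.  A tight sequence in the Kleene-Brouwer order followed by ω* leaves
    ω* iff there is a path, so that reticence is not needed.  The two structures
    differ by a twist which only a coherent family of finite sets of nodes, one
    for each level and starting with the root, can undo modulo 2; such a family
    is supported by a path. *)

Opaque Cantor.to_nat Cantor.of_nat.

(** * Effective functionals *)

(** Two obstacles shape the proof. The notions speak of concrete [code] programs, so each
    construction has to be shown computable in that model. [effective] packages total functionals so
    that one tactic can do this; a step-bounded evaluator makes arbitrary programs accessible to it,
    and partial programs arise by unbounded search over total tests. Secondly, a name constrains a
    structure or an order only on its universe. Values elsewhere are arbitrary or missing, so two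
    records with the same name can differ there, and a program for an isomorphism has to stay
    undefined there. Hence names are replaced by total functions [X] whose clauses are guarded by
    membership in the universe. In the isomorphism problem, counting modulo 2 serves two purposes.
    Flipping one node per level along a path preserves membership plus the parity of the children,
    and conversely an odd number of children is a nonzero one, so a child to continue with exists.
    Elements are finite sets because parities are then computable. *)

Class Enc (A : Type) := enc : A -> nat.

Instance enc_nat : Enc nat := fun n => n.
Instance enc_bool : Enc bool := Nat.b2n.
Instance enc_pair {A B} {EA : Enc A} {EB : Enc B} : Enc (A * B) :=
  fun p => ⟨enc (fst p), enc (snd p)⟩.
Instance enc_option {A} {EA : Enc A} : Enc (option A) :=
  fun o => match o with None => 0 | Some a => S (enc a) end.
(** On [list nat] this is convertible with [seqcode]. A list also has the same code as the option of
    its head and tail, so that [uncons] costs nothing. *)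
Instance enc_list {A} {EA : Enc A} : Enc (list A) :=
  fix lenc l := match l with nil => 0 | x :: l => S ⟨enc x, lenc l⟩ end.

(** One program serves all oracles and halts on all codes; numbers that are not codes are
    unconstrained. Since [O] is arbitrary, it can be an oracle set, a function quantified over, or a
    string padded with zeros. *)
Definition effective {A B} {EA : Enc A} {EB : Enc B} (F : (nat -> nat) -> A -> B) : Prop :=
  exists c, forall O a, ev O c (enc a) (enc (F O a)).

Section Closure.
Context {A B C E : Type} {EA : Enc A} {EB : Enc B} {EC : Enc C} {EE : Enc E}.

Lemma effective_ext (F G : (nat -> nat) -> A -> B) :
  (forall O a, F O a = G O a) -> effective F -> effective G.
Proof. intros H [c Hc]. exists c. intros O a. rewrite <- H. apply Hc. Qed.

Definition cid : code := CPair CLeft CRight.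

Lemma ev_cid O x : ev O cid x x.
Proof.
  exists (fst (Cantor.of_nat x)), (snd (Cantor.of_nat x)). repeat split.
  now rewrite <- surjective_pairing, Cantor.cancel_to_of.
Qed.

(** The identity program changes the data type whenever codes agree. Numbers turn into pairs,
    options or lists in this way. *)
Lemma effective_recode (f : A -> B) :
  (forall a, enc (f a) = enc a) -> effective (fun _ a => f a).
Proof. intros H. exists cid. intros O a. rewrite H. apply ev_cid. Qed.

Lemma effective_id : effective (fun _ (a : A) => a).
Proof. exists cid. intros. apply ev_cid. Qed.

Fixpoint cconst (n : nat) : code :=
  match n with 0 => CZero | S n => CComp CSucc (cconst n) end.

Lemma ev_cconst O n x : ev O (cconst n) x n.
Proof. induction n as [|n IH]; simpl; [reflexivity|]. exists n. auto. Qed.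

Lemma effective_const (b : B) : effective (fun _ (_ : A) => b).
Proof. exists (cconst (enc b)). intros. apply ev_cconst. Qed.

Lemma effective_comp (G : (nat -> nat) -> B -> C) (F : (nat -> nat) -> A -> B) :
  effective G -> effective F -> effective (fun O a => G O (F O a)).
Proof.
  intros [g Hg] [f Hf]. exists (CComp g f). intros O a. simpl.
  exists (enc (F O a)). auto.
Qed.

Lemma effective_oracle (F : (nat -> nat) -> A -> nat) :
  effective F -> effective (fun O a => O (F O a)).
Proof.
  intros [f Hf]. exists (CComp COracle f). intros O a. simpl.
  exists (enc (F O a)). auto.
Qed.

Lemma effective_pair (F : (nat -> nat) -> A -> B) (G : (nat -> nat) -> A -> C) :
  effective F -> effective G -> effective (fun O a => (F O a, G O a)).
Proof.
  intros [f Hf] [g Hg]. exists (CPair f g). intros O a. simpl.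
  exists (enc (F O a)), (enc (G O a)). auto.
Qed.

Lemma effective_fst (F : (nat -> nat) -> A -> B * C) :
  effective F -> effective (fun O a => fst (F O a)).
Proof.
  intros [f Hf]. exists (CComp CLeft f). intros O a. simpl.
  exists (enc (F O a)). split; [auto|]. unfold enc at 2, enc_pair.
  now rewrite Cantor.cancel_of_to.
Qed.

Lemma effective_snd (F : (nat -> nat) -> A -> B * C) :
  effective F -> effective (fun O a => snd (F O a)).
Proof.
  intros [f Hf]. exists (CComp CRight f). intros O a. simpl.
  exists (enc (F O a)). split; [auto|]. unfold enc at 2, enc_pair.
  now rewrite Cantor.cancel_of_to.
Qed.

Lemma effective_S (F : (nat -> nat) -> A -> nat) :
  effective F -> effective (fun O a => S (F O a)).
Proof.
  intros [f Hf]. exists (CComp CSucc f). intros O a. simpl.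
  exists (enc (F O a)). auto.
Qed.

Lemma effective_Some (F : (nat -> nat) -> A -> B) :
  effective F -> effective (fun O a => Some (F O a)).
Proof.
  intros [f Hf]. exists (CComp CSucc f). intros O a. simpl.
  exists (enc (F O a)). auto.
Qed.

Lemma effective_cons (F : (nat -> nat) -> A -> B) (G : (nat -> nat) -> A -> list B) :
  effective F -> effective G -> effective (fun O a => F O a :: G O a).
Proof.
  intros [f Hf] [g Hg]. exists (CComp CSucc (CPair f g)). intros O a. simpl.
  exists ⟨enc (F O a), enc (G O a)⟩. split; [|reflexivity].
  exists (enc (F O a)), (enc (G O a)). auto.
Qed.

Definition nrec {T} (x : T) (g : nat -> T -> T) (n : nat) : T :=
  nat_rect (fun _ => T) x g n.

Lemma effective_nrec (X : (nat -> nat) -> A -> B)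
    (G : (nat -> nat) -> A -> nat -> B -> B) (N : (nat -> nat) -> A -> nat) :
  effective X -> effective (fun O p => G O (fst p) (fst (snd p)) (snd (snd p))) ->
  effective N -> effective (fun O a => nrec (X O a) (G O a) (N O a)).
Proof.
  intros [x Hx] [g Hg] [n Hn]. exists (CComp (CPrec x g) (CPair cid n)).
  intros O a. exists ⟨enc a, N O a⟩. split.
  { exists (enc a), (N O a). split; [apply ev_cid|]. split; [apply Hn|reflexivity]. }
  simpl. rewrite Cantor.cancel_of_to. simpl.
  induction (N O a) as [|m IH]; simpl; [apply Hx|].
  eexists. split; [exact IH|]. apply (Hg O (a, (m, nrec (X O a) (G O a) m))).
Qed.

(** Case distinctions and recursions get names so that the tactic [eff] can recognise them by their
    head symbol. *)
Definition ite {T} (b : bool) (x y : T) : T := if b then x else y.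

Lemma effective_ite (P : (nat -> nat) -> A -> bool) (X Y : (nat -> nat) -> A -> B) :
  effective P -> effective X -> effective Y ->
  effective (fun O a => ite (P O a) (X O a) (Y O a)).
Proof.
  intros [p Hp] [x Hx] [y Hy].
  (* Recursion along the code of the Boolean: no round yields [Y], one round discards that value for
     [X]. *)
  exists (CComp (CPrec y (CComp x CLeft)) (CPair cid p)).
  intros O a. exists ⟨enc a, enc (P O a)⟩. split.
  { exists (enc a), (enc (P O a)). split; [apply ev_cid|]. split; [apply Hp|reflexivity]. }
  simpl. rewrite Cantor.cancel_of_to. simpl.
  destruct (P O a); simpl; [|apply Hy].
  eexists. split; [apply Hy|]. exists (enc a). rewrite Cantor.cancel_of_to.
  split; [reflexivity|apply Hx].
Qed.

Definition opt_elim {S T} (x : T) (g : S -> T) (o : option S) : T :=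
  match o with None => x | Some b => g b end.

Definition cpred : code := CComp (CPrec CZero (CComp CLeft CRight)) (CPair CZero cid).
Definition csg : code := CComp (CPrec CZero (CComp CSucc CZero)) (CPair CZero cid).

Lemma ev_cpred O n : ev O cpred n (pred n).
Proof.
  exists ⟨0, n⟩. split.
  { exists 0, n. split; [reflexivity|]. split; [apply ev_cid|reflexivity]. }
  simpl. rewrite Cantor.cancel_of_to. simpl.
  induction n as [|n IH]; simpl; [reflexivity|].
  eexists. split; [exact IH|]. eexists. split; [reflexivity|].
  now rewrite !Cantor.cancel_of_to; simpl; rewrite Cantor.cancel_of_to.
Qed.

Lemma ev_csg O n : ev O csg n (match n with 0 => 0 | S _ => 1 end).
Proof.
  exists ⟨0, n⟩. split.
  { exists 0, n. split; [reflexivity|]. split; [apply ev_cid|reflexivity]. }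
  simpl. rewrite Cantor.cancel_of_to. simpl.
  induction n as [|n IH]; simpl; [reflexivity|].
  eexists. split; [exact IH|]. eexists. split; reflexivity.
Qed.

(* The program for [G] may diverge on numbers outside the range of [enc], so it
   is only run when the option is nonempty. *)
Lemma effective_opt_elim (X : (nat -> nat) -> A -> B) (G : (nat -> nat) -> A -> C -> B)
    (N : (nat -> nat) -> A -> option C) :
  effective X -> effective (fun O p => G O (fst p) (snd p)) -> effective N ->
  effective (fun O a => opt_elim (X O a) (G O a) (N O a)).
Proof.
  intros [x Hx] [g Hg] [n Hn].
  exists (CComp (CPrec (CComp x CLeft) (CComp g CLeft))
            (CPair (CPair cid (CComp cpred n)) (CComp csg n))).
  intros O a.
  exists ⟨⟨enc a, pred (enc (N O a))⟩, match enc (N O a) with 0 => 0 | S _ => 1 end⟩.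
  split.
  { eexists _, _. split; [|split; [|reflexivity]].
    - eexists _, _. split; [apply ev_cid|split; [|reflexivity]].
      eexists. split; [apply Hn|]. apply ev_cpred.
    - eexists. split; [apply Hn|]. apply ev_csg. }
  cbn [ev]. rewrite Cantor.cancel_of_to. cbn [fst snd].
  destruct (N O a) as [b|]; simpl.
  - eexists. split.
    + eexists. split; [reflexivity|]. rewrite Cantor.cancel_of_to. apply Hx.
    + eexists. split; [reflexivity|]. rewrite Cantor.cancel_of_to.
      apply (Hg O (a, b)).
  - eexists. split; [reflexivity|]. rewrite Cantor.cancel_of_to. apply Hx.
Qed.

Definition uncons {T} (l : list T) : option (T * list T) :=
  match l with nil => None | x :: l => Some (x, l) end.

Definition list_elim {S T} (x : T) (g : S -> list S -> T) (l : list S) : T :=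
  match l with nil => x | y :: l => g y l end.

Definition nat_elim {T} (x : T) (g : nat -> T) (n : nat) : T :=
  match n with 0 => x | S n => g n end.
End Closure.

Lemma effective_list_elim {A B C} {EA : Enc A} {EB : Enc B} {EC : Enc C}
    (X : (nat -> nat) -> A -> B) (G : (nat -> nat) -> A -> C -> list C -> B)
    (N : (nat -> nat) -> A -> list C) :
  effective X -> effective (fun O p => G O (fst p) (fst (snd p)) (snd (snd p))) ->
  effective N -> effective (fun O a => list_elim (X O a) (G O a) (N O a)).
Proof.
  intros HX HG HN.
  apply (effective_ext (fun O a => opt_elim (X O a)
           (fun b => G O a (fst b) (snd b)) (uncons (N O a)))).
  { intros O a. now destruct (N O a). }
  apply effective_opt_elim; [exact HX|exact HG|].
  apply (effective_comp (fun _ => uncons)); [|exact HN].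
  apply effective_recode. now intros [|].
Qed.

Lemma effective_nat_elim {A B} {EA : Enc A} {EB : Enc B}
    (X : (nat -> nat) -> A -> B) (G : (nat -> nat) -> A -> nat -> B)
    (N : (nat -> nat) -> A -> nat) :
  effective X -> effective (fun O p => G O (fst p) (snd p)) ->
  effective N -> effective (fun O a => nat_elim (X O a) (G O a) (N O a)).
Proof.
  intros HX HG HN.
  apply (effective_ext (fun O a => opt_elim (X O a) (G O a)
     (match N O a with 0 => None | S n => Some n end))).
  { intros O a. now destruct (N O a). }
  apply effective_opt_elim; [exact HX|exact HG|].
  apply (effective_comp (fun _ n => match n with 0 => None | S n => Some n end));
    [|exact HN].
  apply effective_recode. now intros [|].
Qed.

Definition eff1 {A B} {EA : Enc A} {EB : Enc B} (h : A -> B) : Prop :=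
  effective (fun _ a => h a).
Definition eff2 {A B C} {EA : Enc A} {EB : Enc B} {EC : Enc C} (h : A -> B -> C) : Prop :=
  effective (fun _ p => h (fst p) (snd p)).
Definition eff3 {A B C E} {EA : Enc A} {EB : Enc B} {EC : Enc C} {EE : Enc E}
    (h : A -> B -> C -> E) : Prop :=
  effective (fun _ p => h (fst p) (fst (snd p)) (snd (snd p))).

Section Apply.
Context {A B C E F : Type} {EA : Enc A} {EB : Enc B} {EC : Enc C} {EE : Enc E} {EF : Enc F}.

Lemma eff1_app (h : B -> C) (f : (nat -> nat) -> A -> B) :
  eff1 h -> effective f -> effective (fun O a => h (f O a)).
Proof. intros H Hf. exact (effective_comp _ _ H Hf). Qed.

Lemma eff2_app (h : B -> C -> E) (f : (nat -> nat) -> A -> B) (g : (nat -> nat) -> A -> C) :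
  eff2 h -> effective f -> effective g -> effective (fun O a => h (f O a) (g O a)).
Proof. intros H Hf Hg. exact (effective_comp _ _ H (effective_pair _ _ Hf Hg)). Qed.

Lemma eff3_app (h : B -> C -> E -> F) (f : (nat -> nat) -> A -> B)
    (g : (nat -> nat) -> A -> C) (k : (nat -> nat) -> A -> E) :
  eff3 h -> effective f -> effective g -> effective k ->
  effective (fun O a => h (f O a) (g O a) (k O a)).
Proof.
  intros H Hf Hg Hk.
  exact (effective_comp _ _ H (effective_pair _ _ Hf (effective_pair _ _ Hg Hk))).
Qed.

Lemma effective_app2 (H : (nat -> nat) -> B -> C -> E) (f : (nat -> nat) -> A -> B)
    (g : (nat -> nat) -> A -> C) :
  effective (fun O p => H O (fst p) (snd p)) -> effective f -> effective g ->
  effective (fun O a => H O (f O a) (g O a)).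
Proof. intros HH Hf Hg. exact (effective_comp _ _ HH (effective_pair _ _ Hf Hg)). Qed.

Lemma effective_app3 (H : (nat -> nat) -> B -> C -> E -> F) (f : (nat -> nat) -> A -> B)
    (g : (nat -> nat) -> A -> C) (k : (nat -> nat) -> A -> E) :
  effective (fun O p => H O (fst p) (fst (snd p)) (snd (snd p))) ->
  effective f -> effective g -> effective k ->
  effective (fun O a => H O (f O a) (g O a) (k O a)).
Proof.
  intros HH Hf Hg Hk.
  exact (effective_comp _ _ HH (effective_pair _ _ Hf (effective_pair _ _ Hg Hk))).
Qed.
End Apply.

(* Automation for effectiveness proofs *)
Create HintDb eff.

(** A hook, redefined once folds, [forallb] and [map] have been treated. *)
Ltac eff_special := fail.

Ltac eff_step :=
  cbv beta;
  match goal with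
  | |- eff1 _ => solve [eauto with eff] || unfold eff1
  | |- eff2 _ => solve [eauto with eff] || unfold eff2
  | |- eff3 _ => solve [eauto with eff] || unfold eff3
  | |- effective (fun O a => a) => apply effective_id
  | |- effective (fun O a => ?b) => apply (effective_const b)
  | |- effective (fun O a => fst (@?f O a)) => apply (effective_fst f)
  | |- effective (fun O a => snd (@?f O a)) => apply (effective_snd f)
  | |- effective (fun O a => (@?f O a, @?g O a)) => apply (effective_pair f g)
  | |- effective (fun O a => O (@?f O a)) => apply (effective_oracle f)
  | |- effective (fun O a => S (@?f O a)) => apply (effective_S f)
  | |- effective (fun O a => Some (@?f O a)) => apply (effective_Some f)
  | |- effective (fun O a => @?f O a :: @?g O a) => apply (effective_cons f g)
  | |- effective (fun O a => nrec (@?x O a) (@?g O a) (@?n O a)) =>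
      apply (effective_nrec x g n)
  | |- effective (fun O a => ite (@?x O a) (@?g O a) (@?n O a)) =>
      apply (effective_ite x g n)
  | |- effective (fun O a => opt_elim (@?x O a) (@?g O a) (@?n O a)) =>
      apply (effective_opt_elim x g n)
  | |- effective (fun O a => list_elim (@?x O a) (@?g O a) (@?n O a)) =>
      apply (effective_list_elim x g n)
  | |- effective (fun O a => nat_elim (@?x O a) (@?g O a) (@?n O a)) =>
      apply (effective_nat_elim x g n)
  | |- effective _ => eff_special
  | H : effective ?F |- effective ?F => exact H
  | H : effective ?F |- effective (fun O a => ?F O (@?f O a)) =>
      apply (effective_comp F f H)
  | H : effective (fun O p => ?F O (fst p) (snd p)) |-
      effective (fun O a => ?F O (@?f O a) (@?g O a)) =>
      apply (effective_app2 F f g H)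
  | H : effective (fun O p => ?F O (fst p) (fst (snd p)) (snd (snd p))) |-
      effective (fun O a => ?F O (@?f O a) (@?g O a) (@?k O a)) =>
      apply (effective_app3 F f g k H)
  | |- effective (fun O a => ?h (@?f O a) (@?g O a) (@?k O a)) =>
      apply (eff3_app h f g k); [solve [eauto with eff]|..]
  | |- effective (fun O a => ?h (@?f O a) (@?g O a)) =>
      apply (eff2_app h f g); [solve [eauto with eff]|..]
  | |- effective (fun O a => ?h (@?f O a)) =>
      apply (eff1_app h f); [solve [eauto with eff]|..]
  end.
Ltac eff := repeat eff_step.

Lemma eff_ext1 {A B} {EA : Enc A} {EB : Enc B} (h k : A -> B) :
  (forall a, h a = k a) -> eff1 h -> eff1 k.
Proof. intros H. apply effective_ext. auto. Qed.

Lemma eff_ext2 {A B C} {EA : Enc A} {EB : Enc B} {EC : Enc C} (h k : A -> B -> C) :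
  (forall a b, h a b = k a b) -> eff2 h -> eff2 k.
Proof. intros H. apply effective_ext. auto. Qed.

(** * Effective arithmetic and Boolean functions *)

Lemma eff_add : eff2 Nat.add.
Proof.
  apply (eff_ext2 (fun a b => nrec b (fun _ => S) a)); [|eff].
  intros a b; induction a; simpl in *; congruence.
Qed.
#[export] Hint Resolve eff_add : eff.

Lemma eff_pred : eff1 pred.
Proof. apply (eff_ext1 (nat_elim 0 (fun n => n))); [now intros [|]|eff]. Qed.
#[export] Hint Resolve eff_pred : eff.

Lemma eff_sub : eff2 Nat.sub.
Proof.
  apply (eff_ext2 (fun a b => nrec a (fun _ => pred) b)); [|eff].
  intros a b; induction b; simpl in *; [lia|]. rewrite IHb; lia.
Qed.
#[export] Hint Resolve eff_sub : eff.

Lemma eff_mul : eff2 Nat.mul.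
Proof.
  apply (eff_ext2 (fun a b => nrec 0 (fun _ r => b + r) a)); [|eff].
  intros a b; induction a; simpl in *; congruence.
Qed.
#[export] Hint Resolve eff_mul : eff.

Lemma eff_leb : eff2 Nat.leb.
Proof.
  apply (eff_ext2 (fun a b => nat_elim true (fun _ => false) (a - b))); [|eff].
  intros a b. destruct (Nat.leb_spec a b); destruct (a - b) eqn:?; simpl; trivial; lia.
Qed.
#[export] Hint Resolve eff_leb : eff.

Lemma eff_ltb : eff2 Nat.ltb.
Proof. unfold Nat.ltb. eff. Qed.
#[export] Hint Resolve eff_ltb : eff.

Lemma eff_andb : eff2 andb.
Proof. apply (eff_ext2 (fun a b => ite a b false)); [now intros [] []|eff]. Qed.
Lemma eff_orb : eff2 orb.
Proof. apply (eff_ext2 (fun a b => ite a true b)); [now intros [] []|eff]. Qed.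
Lemma eff_negb : eff1 negb.
Proof. apply (eff_ext1 (fun a => ite a false true)); [now intros []|eff]. Qed.
Lemma eff_xorb : eff2 xorb.
Proof. apply (eff_ext2 (fun a b => ite a (ite b false true) b)); [now intros [] []|eff]. Qed.
Lemma eff_eqb_bool : eff2 Bool.eqb.
Proof. apply (eff_ext2 (fun a b => ite a b (ite b false true))); [now intros [] []|eff]. Qed.
Lemma eff_b2n : eff1 Nat.b2n.
Proof. now apply effective_recode. Qed.
#[export] Hint Resolve eff_andb eff_orb eff_negb eff_xorb eff_eqb_bool eff_b2n : eff.

Lemma eff_implb : eff2 implb.
Proof. apply (eff_ext2 (fun a b => ite a b true)); [now intros [] []|eff]. Qed.
#[export] Hint Resolve eff_implb : eff.

Lemma eff_eqb : eff2 Nat.eqb.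
Proof.
  apply (eff_ext2 (fun a b => (a <=? b) && (b <=? a))); [|eff].
  intros a b. destruct (Nat.leb_spec a b), (Nat.leb_spec b a), (Nat.eqb_spec a b); trivial; lia.
Qed.
#[export] Hint Resolve eff_eqb : eff.

Lemma eff_of_nat : eff1 Cantor.of_nat.
Proof.
  apply effective_recode. intros n.
  change (Cantor.to_nat (fst (Cantor.of_nat n), snd (Cantor.of_nat n)) = n).
  now rewrite <- surjective_pairing, Cantor.cancel_to_of.
Qed.
Lemma eff_to_nat : eff1 Cantor.to_nat.
Proof. apply effective_recode. now intros []. Qed.
#[export] Hint Resolve eff_of_nat eff_to_nat : eff.

Lemma eff_odd : eff1 Nat.odd.
Proof.
  apply (eff_ext1 (nrec false (fun _ => negb))); [|eff].
  intros n. induction n as [|n IH]; [reflexivity|].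
  change (negb (nrec false (fun _ => negb) n) = Nat.odd (S n)). rewrite IH.
  now rewrite Nat.odd_succ, <- Nat.negb_odd.
Qed.
#[export] Hint Resolve eff_odd : eff.

Lemma eff_div2 : eff1 Nat.div2.
Proof.
  apply (eff_ext1 (nrec 0 (fun n r => ite (Nat.odd n) (S r) r))); [|eff].
  set (h := fun _ _ => _). intros n. induction n as [|n IH]; [reflexivity|].
  change (h n (nrec 0 h n) = Nat.div2 (S n)). rewrite IH. unfold h.
  pose proof (Nat.div2_odd n). pose proof (Nat.div2_odd (S n)).
  rewrite Nat.odd_succ, <- Nat.negb_odd in H0.
  destruct (Nat.odd n); cbn [ite negb Nat.b2n] in *; lia.
Qed.
#[export] Hint Resolve eff_div2 : eff.

Lemma eff_testbit : eff2 Nat.testbit.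
Proof.
  apply (eff_ext2 (fun n i => Nat.odd (nrec n (fun _ => Nat.div2) i))); [|eff].
  intros n i. revert n. induction i as [|i IH]; intros n; [reflexivity|].
  cbn [Nat.testbit]. rewrite <- IH. f_equal. clear IH.
  induction i as [|i IH]; [reflexivity|]. cbn in *. now rewrite IH.
Qed.
#[export] Hint Resolve eff_testbit : eff.

(** * Effective list operations *)

Lemma length_le_enc {A} {EA : Enc A} (l : list A) : length l <= enc l.
Proof.
  induction l as [|x l IH]; simpl; [lia|].
  pose proof (Cantor.to_nat_non_decreasing (enc x) (enc l)). cbn in *. lia.
Qed.

(** The loop runs as often as the code of the list says: this number is at hand without computation
    and is at least the length. Surplus rounds meet the empty list and change nothing. *)
Lemma effective_fold_left {A B C} {EA : Enc A} {EB : Enc B} {EC : Enc C}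
    (G : (nat -> nat) -> A -> B -> C -> B) (L : (nat -> nat) -> A -> list C)
    (X : (nat -> nat) -> A -> B) :
  effective (fun O p => G O (fst p) (fst (snd p)) (snd (snd p))) ->
  effective L -> effective X ->
  effective (fun O a => fold_left (G O a) (L O a) (X O a)).
Proof.
  intros HG HL HX.
  apply (effective_ext (fun O a => fst (nrec (X O a, L O a)
     (fun _ st => list_elim st (fun y l => (G O a (fst st) y, l)) (snd st)) (enc (L O a))))).
  - intros O a. pose proof (length_le_enc (L O a)) as Hn. revert Hn.
    generalize (enc (L O a)) as n. generalize (X O a) as x, (L O a) as l.
    intros x l n. revert x l.
    set (step := fun _ st => _).
    assert (shift : forall n st, nrec st step (S n) = nrec (step 0 st) step n).
    { clear. induction n as [|n IH]; intros st; [reflexivity|].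
      change (step (S n) (nrec st step (S n)) = step n (nrec (step 0 st) step n)).
      now rewrite IH. }
    induction n as [|n IH]; intros x [|y l] Hn; simpl in Hn; try lia; [reflexivity| |].
    + rewrite shift. apply (IH x nil). simpl; lia.
    + rewrite shift. apply (IH (G O a x y) l). lia.
  - eff. apply (eff1_app (enc : list C -> nat)); [|exact HL].
    now apply effective_recode.
Qed.

Lemma forallb_fold {A} (p : A -> bool) l : fold_left (fun b x => b && p x) l true = forallb p l.
Proof.
  enough (H : forall b, fold_left (fun b x => b && p x) l b = b && forallb p l) by apply H.
  induction l as [|x l IH]; intros b; simpl; [now rewrite andb_true_r|].
  now rewrite IH, andb_assoc.
Qed.

Lemma effective_forallb {A C} {EA : Enc A} {EC : Enc C}
    (G : (nat -> nat) -> A -> C -> bool) (L : (nat -> nat) -> A -> list C) :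
  effective (fun O p => G O (fst p) (snd p)) -> effective L ->
  effective (fun O a => forallb (G O a) (L O a)).
Proof.
  intros HG HL.
  apply (effective_ext (fun O a => fold_left (fun b x => b && G O a x) (L O a) true)).
  { intros. apply forallb_fold. }
  apply effective_fold_left; eff.
Qed.

Lemma rev_fold {A} (l : list A) : fold_left (fun r x => x :: r) l [] = rev l.
Proof.
  enough (H : forall r, fold_left (fun r x => x :: r) l r = rev l ++ r)
    by (rewrite H; apply app_nil_r).
  induction l as [|x l IH]; intros r; simpl; [reflexivity|].
  now rewrite IH, <- app_assoc.
Qed.

Lemma eff_rev {A} {EA : Enc A} : eff1 (@rev A).
Proof. apply (eff_ext1 _ _ rev_fold). apply effective_fold_left; eff. Qed.
#[export] Hint Resolve eff_rev : eff.

Lemma effective_map {A B C} {EA : Enc A} {EB : Enc B} {EC : Enc C}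
    (G : (nat -> nat) -> A -> C -> B) (L : (nat -> nat) -> A -> list C) :
  effective (fun O p => G O (fst p) (snd p)) -> effective L ->
  effective (fun O a => map (G O a) (L O a)).
Proof.
  intros HG HL.
  apply (effective_ext (fun O a => rev (fold_left (fun r x => G O a x :: r) (L O a) []))).
  { intros O a. rewrite <- (rev_involutive (map _ _)). f_equal.
    enough (H : forall r, fold_left (fun r x => G O a x :: r) (L O a) r
              = rev (map (G O a) (L O a)) ++ r) by (rewrite H; apply app_nil_r).
    induction (L O a) as [|x l IH]; intros r; simpl; [reflexivity|].
    now rewrite IH, <- app_assoc. }
  apply (eff1_app (@rev B)); [apply eff_rev|]. apply effective_fold_left; eff.
Qed.

Ltac eff_special ::=
  match goal with
  | |- effective (fun O a => fold_left (@?g O a) (@?l O a) (@?x O a)) =>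
      apply (effective_fold_left g l x)
  | |- effective (fun O a => forallb (@?g O a) (@?l O a)) =>
      apply (effective_forallb g l)
  | |- effective (fun O a => map (@?g O a) (@?l O a)) =>
      apply (effective_map g l)
  end.

Lemma eff_length {A} {EA : Enc A} : eff1 (@length A).
Proof.
  apply (eff_ext1 (fun l => fold_left (fun n _ => S n) l 0)); [|eff].
  intros l. enough (H : forall n, fold_left (fun n _ => S n) l n = length l + n)
    by (rewrite H; lia).
  induction l as [|x l IH]; intros n; simpl; [reflexivity|]. rewrite IH. lia.
Qed.

Lemma eff_app {A} {EA : Enc A} : eff2 (@app A).
Proof.
  apply (eff_ext2 (fun l r => fold_left (fun r x => x :: r) (rev l) r)); [|eff].
  intros l r. rewrite <- fold_left_rev_right, rev_involutive.
  induction l as [|x l IH]; simpl; congruence.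
Qed.

Lemma eff_tl {A} {EA : Enc A} : eff1 (@tl A).
Proof.
  apply (eff_ext1 (fun l => list_elim l (fun _ r => r) l)); [now intros [|]|eff].
Qed.

Lemma eff_hd {A} {EA : Enc A} : eff2 (@hd A).
Proof.
  apply (eff_ext2 (fun d l => list_elim d (fun x _ => x) l)); [now intros d [|]|eff].
Qed.
#[export] Hint Resolve eff_length eff_app eff_tl eff_hd : eff.

Lemma eff_nth {A} {EA : Enc A} : eff3 (@nth A).
Proof.
  apply (effective_ext (fun _ p => hd (snd (snd p))
    (nrec (fst (snd p)) (fun _ l => tl l) (fst p)))); [|eff].
  intros _ [i [l d]]. simpl. revert l. induction i as [|i IH]; intros l; [now destruct l|].
  assert (shift : forall l : list A, nrec l (fun _ r => tl r) (S i) = nrec (tl l) (fun _ r => tl r) i).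
  { clear. induction i as [|i IH]; intros l; [reflexivity|].
    change (tl (nrec l (fun _ (r : list A) => tl r) (S i)) = tl (nrec (tl l) (fun _ r => tl r) i)).
    now rewrite IH. }
  rewrite shift, IH. destruct l; [destruct i|]; reflexivity.
Qed.

Lemma eff_seq : eff2 seq.
Proof.
  apply (eff_ext2 (fun s n => rev (nrec [] (fun i r => (s + i) :: r) n))); [|eff].
  intros s n. induction n as [|n IH]; [reflexivity|].
  rewrite seq_S, <- IH. reflexivity.
Qed.
#[export] Hint Resolve eff_nth eff_seq : eff.

(** * Decoding of finite sequences *)

Fixpoint seqdec_fuel (fuel n : nat) : list nat :=
  match fuel, n with
  | S fuel, S n => fst (Cantor.of_nat n) :: seqdec_fuel fuel (snd (Cantor.of_nat n))
  | _, _ => []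
  end.

Definition seqdec (n : nat) : list nat := seqdec_fuel n n.

Lemma seqdecK n : seqcode (seqdec n) = n.
Proof.
  unfold seqdec. enough (H : forall f n, n <= f -> seqcode (seqdec_fuel f n) = n) by auto.
  clear n. induction f as [|f IH]; intros [|n] Hn; try lia; try reflexivity.
  destruct (Cantor.of_nat n) as [a b] eqn:E. simpl. rewrite E. simpl.
  assert (En : ⟨a, b⟩ = n) by (rewrite <- E; apply Cantor.cancel_to_of).
  pose proof (Cantor.to_nat_non_decreasing a b).
  rewrite IH by lia. now rewrite En.
Qed.

Lemma seqcode_inj l l' : seqcode l = seqcode l' -> l = l'.
Proof.
  revert l'. induction l as [|x l IH]; intros [|y l']; simpl; try discriminate; [trivial|].
  intros [= H]. apply Cantor.to_nat_inj in H. injection H as -> H. now rewrite (IH l').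
Qed.

Lemma seqcodeK l : seqdec (seqcode l) = l.
Proof. apply seqcode_inj, seqdecK. Qed.

(** A number and the list it decodes to have the same code. *)
Lemma eff_seqdec : eff1 seqdec.
Proof. apply effective_recode, seqdecK. Qed.

Lemma eff_seqcode : eff1 seqcode.
Proof. now apply effective_recode. Qed.
#[export] Hint Resolve eff_seqdec eff_seqcode : eff.

(** * Substitution for the oracle, and the use principle *)

Lemma ev_comp O f g x u y : ev O g x u -> (ev O (CComp f g) x y <-> ev O f u y).
Proof.
  intros Hg. split.
  - intros (u' & Hu' & Hy). now rewrite (ev_functional O g x u u' Hg Hu').
  - intros Hy. exists u. auto.
Qed.

Lemma ev_pair O f g x u v : ev O f x u -> ev O g x v -> ev O (CPair f g) x ⟨u, v⟩.
Proof. intros Hf Hg. exists u, v. auto. Qed.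

Lemma ev_left O a b y : ev O CLeft ⟨a, b⟩ y <-> y = a.
Proof. simpl. now rewrite Cantor.cancel_of_to. Qed.

Lemma ev_right O a b y : ev O CRight ⟨a, b⟩ y <-> y = b.
Proof. simpl. now rewrite Cantor.cancel_of_to. Qed.

(** [CPrec] and [CMin] pair their whole parameter with the loop variables. When the parameter is
    itself [⟨a, x⟩], this moves [a] back to the outside. *)
Definition cassoc : code := CPair (CComp CLeft CLeft) (CPair (CComp CRight CLeft) CRight).

Lemma ev_cassoc O a b c : ev O cassoc ⟨⟨a, b⟩, c⟩ ⟨a, ⟨b, c⟩⟩.
Proof.
  repeat apply ev_pair.
  - apply (ev_comp _ _ _ _ ⟨a, b⟩); now apply ev_left.
  - apply (ev_comp _ _ _ _ ⟨a, b⟩); [now apply ev_left|now apply ev_right].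
  - now apply ev_right.
Qed.

(** [csubst g c] runs [c] on the second component of its input and answers the
    oracle queries by [g], which also sees the first component. *)
Fixpoint csubst (g c : code) : code :=
  match c with
  | CZero => CZero
  | CSucc => CComp CSucc CRight
  | CLeft => CComp CLeft CRight
  | CRight => CComp CRight CRight
  | COracle => g
  | CPair c1 c2 => CPair (csubst g c1) (csubst g c2)
  | CComp c1 c2 => CComp (csubst g c1) (CPair CLeft (csubst g c2))
  | CPrec c1 c2 => CComp (CPrec (csubst g c1) (CComp (csubst g c2) cassoc))
      (CPair (CPair CLeft (CComp CLeft CRight)) (CComp CRight CRight))
  | CMin c1 => CMin (CComp (csubst g c1) cassoc)
  end.

Lemma prec_graph_iff F G F' G' n y :
  (forall y, F y <-> F' y) -> (forall m r y, G m r y <-> G' m r y) ->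
  prec_graph F G n y <-> prec_graph F' G' n y.
Proof.
  intros HF HG. revert y. induction n as [|n IH]; intros y; simpl; [apply HF|].
  split; intros (r & Hr & Hy); exists r; split; try apply IH; try apply HG; trivial.
Qed.

(** An equivalence rather than an implication, because [c] may diverge; [g] however is total, so no
    query blocks the run. *)
Lemma ev_csubst O O' g a c x y : (forall k, ev O g ⟨a, k⟩ (O' k)) ->
  ev O (csubst g c) ⟨a, x⟩ y <-> ev O' c x y.
Proof.
  intros Hg. revert x y.
  induction c as [| | | | |f IHf h IHh|f IHf h IHh|f IHf h IHh|f IHf];
    intros x y; cbn [csubst].
  - reflexivity.
  - now rewrite (ev_comp _ _ _ _ x) by now apply ev_right.
  - now rewrite (ev_comp _ _ _ _ x) by now apply ev_right.
  - now rewrite (ev_comp _ _ _ _ x) by now apply ev_right.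
  - split; [intros H; exact (ev_functional _ _ _ _ _ H (Hg x))|intros ->; apply Hg].
  - split; intros (u & v & Hu & Hv & E); exists u, v; rewrite ?IHf, ?IHh in *; auto.
  - split.
    + intros (p & (u & v & Hu & Hv & ->) & Hy). apply ev_left in Hu as ->.
      apply IHh in Hv. apply IHf in Hy. exists v. auto.
    + intros (v & Hv & Hy). exists ⟨a, v⟩. split; [|now apply IHf].
      apply ev_pair; [now apply ev_left|now apply IHh].
  - destruct (Cantor.of_nat x) as [b n] eqn:E.
    assert (Ex : x = ⟨b, n⟩) by (rewrite <- E; symmetry; apply Cantor.cancel_to_of).
    assert (H : forall m r z, ev O (CComp (csubst g h) cassoc) ⟨⟨a, b⟩, ⟨m, r⟩⟩ z
                              <-> ev O' h ⟨b, ⟨m, r⟩⟩ z).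
    { intros m r z. rewrite (ev_comp _ _ _ _ ⟨a, ⟨b, ⟨m, r⟩⟩⟩) by apply ev_cassoc.
      apply IHh. }
    rewrite (ev_comp _ _ _ _ ⟨⟨a, b⟩, n⟩).
    + cbn [ev] in H |- *. rewrite E, Cantor.cancel_of_to. cbn [fst snd].
      apply prec_graph_iff; [apply IHf|exact H].
    + rewrite Ex. repeat apply ev_pair.
      * now apply ev_left.
      * apply (ev_comp _ _ _ _ ⟨b, n⟩); [now apply ev_right|now apply ev_left].
      * apply (ev_comp _ _ _ _ ⟨b, n⟩); now apply ev_right.
  - assert (H : forall z v, ev O (CComp (csubst g f) cassoc) ⟨⟨a, x⟩, z⟩ v
                            <-> ev O' f ⟨x, z⟩ v).
    { intros z v. rewrite (ev_comp _ _ _ _ ⟨a, ⟨x, z⟩⟩) by apply ev_cassoc. apply IHf. }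
    cbn [ev] in H |- *. rewrite H.
    split; intros [H0 H1]; (split; [exact H0|]); intros m Hm;
      destruct (H1 m Hm) as [k Hk]; exists k; now apply H.
Qed.

(** This allows a functional to be evaluated on a column of [X], on a padded string, or on the zero
    function. *)
Lemma effective_subst {A B} {EA : Enc A} {EB : Enc B}
    (F : (nat -> nat) -> A -> B) (G : (nat -> nat) -> A -> nat -> nat) :
  effective F -> effective (fun O p => G O (fst p) (snd p)) ->
  effective (fun O a => F (G O a) a).
Proof.
  intros [f Hf] [g Hg]. exists (CComp (csubst g f) (CPair cid cid)). intros O a.
  apply (ev_comp _ _ _ _ ⟨enc a, enc a⟩); [apply ev_pair; apply ev_cid|].
  apply (ev_csubst O (G O a)); [|apply Hf].
  intros k. apply (Hg O (a, k)).
Qed.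

(** A halting computation asks finitely many questions, and [u] lies above all of them. *)
Lemma ev_use O c x y : ev O c x y ->
  exists u, forall O', (forall k, k < u -> O' k = O k) -> ev O' c x y.
Proof.
  revert x y.
  induction c as [| | | | |f IHf h IHh|f IHf h IHh|f IHf h IHh|f IHf];
    intros x y; try (intros H; exists 0; intros; exact H).
  - simpl. intros ->. exists (S x). intros O' H. symmetry. apply H. lia.
  - intros (u & v & Hu & Hv & ->).
    apply IHf in Hu as [k1 H1]. apply IHh in Hv as [k2 H2].
    exists (max k1 k2). intros O' H. exists u, v. split; [|split; [|reflexivity]];
      [apply H1|apply H2]; intros k Hk; apply H; lia.
  - intros (u & Hu & Hv).
    apply IHh in Hu as [k1 H1]. apply IHf in Hv as [k2 H2].
    exists (max k1 k2). intros O' H. exists u. split;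
      [apply H1|apply H2]; intros k Hk; apply H; lia.
  - simpl. revert y. induction (snd (Cantor.of_nat x)) as [|n IH]; intros y; simpl.
    + apply IHf.
    + intros (r & Hr & Hy). apply IH in Hr as [k1 H1]. apply IHh in Hy as [k2 H2].
      exists (max k1 k2). intros O' H. exists r. split;
        [apply H1|apply H2]; intros k Hk; apply H; lia.
  - intros [H0 H1]. apply IHf in H0 as [k0 H0].
    (* The use of a minimisation also covers the finitely many failed candidates below [y]. *)
    assert (H2 : exists u, forall O', (forall k, k < u -> O' k = O k) ->
              forall m, m < y -> exists k, ev O' f ⟨x, m⟩ (S k)).
    { clear H0. induction y as [|y IH]; [exists 0; intros; lia|].
      destruct IH as [u Hu]; [intros; apply H1; lia|].
      destruct (H1 y (Nat.lt_succ_diag_r y)) as [v Hv].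
      apply IHf in Hv as [w Hw]. exists (max u w). intros O' H m Hm.
      destruct (Nat.eq_dec m y) as [->|ne].
      - exists v. apply Hw. intros; apply H; lia.
      - apply Hu; [intros; apply H|]; lia. }
    destruct H2 as [k2 H2]. exists (max k0 k2). intros O' H. split.
    + apply H0. intros; apply H; lia.
    + apply H2. intros; apply H; lia.
Qed.

Lemma enc_bool_inj (a b : bool) : enc a = enc b -> a = b.
Proof. now destruct a, b. Qed.

Lemma effective_use {A} {EA : Enc A} (F : (nat -> nat) -> A -> bool) : effective F ->
  forall O a, exists u, forall O', (forall k, k < u -> O' k = O k) -> F O' a = F O a.
Proof.
  intros [c Hc] O a. destruct (ev_use _ _ _ _ (Hc O a)) as [u Hu]. exists u.
  intros O' H. apply enc_bool_inj. exact (ev_functional _ _ _ _ _ (Hc O' a) (Hu O' H)).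
Qed.

Lemma effective_search {A} {EA : Enc A} (F : (nat -> nat) -> A -> nat -> bool) :
  effective (fun O p => F O (fst p) (snd p)) ->
  exists c, forall O a y, ev O c (enc a) y <->
    F O a y = true /\ forall m, m < y -> F O a m = false.
Proof.
  intros HF.
  (* [CMin] stops at the value 0, so truth is coded by 0 here. *)
  assert (H : effective (fun O p => ite (F O (fst p) (snd p)) 0 1)) by eff.
  destruct H as [c Hc]. exists (CMin c). intros O a y. simpl.
  assert (E : forall m v, ev O c ⟨enc a, m⟩ v <-> v = ite (F O a m) 0 1).
  { intros m v. pose proof (Hc O (a, m)) as Hm. split; [|intros ->; exact Hm].
    intros Hv. exact (ev_functional _ _ _ _ _ Hv Hm). }
  rewrite E. split; intros [H0 H1]; (split; [now destruct (F O a y)|]); intros m Hm.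
  - destruct (H1 m Hm) as [k Hk]. apply E in Hk. now destruct (F O a m).
  - exists 0. apply E. now rewrite (H1 m Hm).
Qed.

(** * The universal machine *)

Lemma decode_fuel_ge5 k m :
  decode_fuel (S k) (5 + m) =
    match m mod 4 with
    | 0 => CPair (decode_fuel k (fst (Cantor.of_nat (m / 4))))
                 (decode_fuel k (snd (Cantor.of_nat (m / 4))))
    | 1 => CComp (decode_fuel k (fst (Cantor.of_nat (m / 4))))
                 (decode_fuel k (snd (Cantor.of_nat (m / 4))))
    | 2 => CPrec (decode_fuel k (fst (Cantor.of_nat (m / 4))))
                 (decode_fuel k (snd (Cantor.of_nat (m / 4))))
    | _ => CMin (decode_fuel k (m / 4))
    end.
Proof. reflexivity. Qed.

Lemma decode_fuel_enough n : forall k, n < k -> decode_fuel k n = decode n.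
Proof.
  unfold decode. enough (H : forall k k', n < k -> n < k' -> decode_fuel k n = decode_fuel k' n)
    by (intros; apply H; lia).
  induction n as [n IH] using lt_wf_ind. intros [|k] [|k'] Hk Hk'; try lia.
  do 5 (destruct n as [|n]; [reflexivity|]).
  change (S (S (S (S (S n))))) with (5 + n) in *. rewrite !decode_fuel_ge5.
  assert (Hr : n / 4 <= n) by (apply Nat.Div0.div_le_upper_bound; lia).
  destruct (Cantor.of_nat (n / 4)) as [a b] eqn:E. simpl.
  assert (En : ⟨a, b⟩ = n / 4) by (rewrite <- E; apply Cantor.cancel_to_of).
  pose proof (Cantor.to_nat_non_decreasing a b).
  rewrite (IH a) with (k' := k'), (IH b) with (k' := k'), (IH (n / 4)) with (k' := k'); trivial; lia.
Qed.

(** Division and remainder by 4 are replaced by [Nat.div2] and subtraction, which [eff] handles;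
    [run_step] computes in exactly this way. *)
Lemma decode_ge5 m :
  let r := Nat.div2 (Nat.div2 m) in
  let a := fst (Cantor.of_nat r) in
  let b := snd (Cantor.of_nat r) in
  decode (5 + m) = match m - 4 * r with
                   | 0 => CPair (decode a) (decode b)
                   | 1 => CComp (decode a) (decode b)
                   | 2 => CPrec (decode a) (decode b)
                   | _ => CMin (decode r)
                   end.
Proof.
  intros r. assert (Er : m / 4 = r).
  { unfold r. rewrite !Nat.div2_div, Nat.Div0.div_div. reflexivity. }
  assert (Em : m mod 4 = m - 4 * r) by (rewrite <- Er; apply Nat.Div0.mod_eq).
  intros a b. rewrite <- Em. unfold decode at 1. rewrite decode_fuel_ge5, Er.
  assert (Hr : r <= m) by (rewrite <- Er; apply Nat.Div0.div_le_upper_bound; lia).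
  assert (En : ⟨a, b⟩ = r) by (unfold a, b; rewrite <- surjective_pairing; apply Cantor.cancel_to_of).
  pose proof (Cantor.to_nat_non_decreasing a b). fold a b.
  rewrite !(decode_fuel_enough a), !(decode_fuel_enough b), (decode_fuel_enough r) by lia.
  reflexivity.
Qed.

(** A frame holds a tag and the data of a suspended computation; a state is
    [(Some e, (x, K))] when [decode e] is about to run on [x], and
    [(None, (y, K))] when the value [y] is returned to the stack [K]. *)
Notation frame := (nat * (nat * (nat * (nat * nat))))%type.
Notation state := (option nat * (nat * list frame))%type.

Definition run_step (O : nat -> nat) (n x : nat) (K : list frame) : state :=
  let r := Nat.div2 (Nat.div2 (n - 5)) in
  let a := fst (Cantor.of_nat r) in
  let b := snd (Cantor.of_nat r) in
  let t := (n - 5) - 4 * r in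
  ite (n <? 5)
    (None, (ite (n =? 0) 0 (ite (n =? 1) (S x) (ite (n =? 2) (fst (Cantor.of_nat x))
       (ite (n =? 3) (snd (Cantor.of_nat x)) (O x)))), K))
    (ite (t =? 0) (Some a, (x, (0, (b, (x, (0, 0)))) :: K))
    (ite (t =? 1) (Some b, (x, (2, (a, (0, (0, 0)))) :: K))
    (ite (t =? 2) (Some a, (fst (Cantor.of_nat x),
         (3, (b, (fst (Cantor.of_nat x), (0, snd (Cantor.of_nat x))))) :: K))
      (Some r, (⟨x, 0⟩, (4, (r, (x, (0, 0)))) :: K))))).

(** Tag 0 awaits the first component of a pair and keeps the second program with its input; tag 1
    awaits the second component and keeps the first. Tag 2 awaits the inner value of a composition.
    Tag 3 is a recursion with step program [p], parameter [q], [r] stages done and [s] to go. Tag 4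
    is a minimisation of [p] on input [q] with current candidate [r]. *)
Definition ret_step (y : nat) (fr : frame) (K : list frame) : state :=
  let p := fst (snd fr) in
  let q := fst (snd (snd fr)) in
  let r := fst (snd (snd (snd fr))) in
  let s := snd (snd (snd (snd fr))) in
  ite (fst fr =? 0) (Some p, (q, (1, (y, (0, (0, 0)))) :: K))
  (ite (fst fr =? 1) (None, (⟨p, y⟩, K))
  (ite (fst fr =? 2) (Some p, (y, K))
  (ite (fst fr =? 3)
    (nat_elim (None, (y, K))
       (fun s' => (Some p, (⟨q, ⟨r, y⟩⟩, (3, (p, (q, (S r, s')))) :: K))) s)
    (nat_elim (None, (r, K))
       (fun _ => (Some p, (⟨q, S r⟩, (4, (p, (q, (S r, 0)))) :: K))) y)))).

(** A value returned to the empty stack is a fixed point, so a halted run may be prolonged at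
    will. *)
Definition step (O : nat -> nat) (s : state) : state :=
  opt_elim
    (list_elim s (fun fr K => ret_step (fst (snd s)) fr K) (snd (snd s)))
    (fun n => run_step O n (fst (snd s)) (snd (snd s))) (fst s).

Definition run (O : nat -> nat) (t : nat) (s : state) : state := nrec s (fun _ => step O) t.

Lemma run_S O t s : run O (S t) s = run O t (step O s).
Proof.
  induction t as [|t IH]; [reflexivity|].
  change (step O (run O (S t) s) = step O (run O t (step O s))). now rewrite IH.
Qed.

Lemma run_add O t t' s : run O (t + t') s = run O t' (run O t s).
Proof.
  revert s. induction t as [|t IH]; intros s; [reflexivity|].
  change (S t + t') with (S (t + t')). now rewrite !run_S, IH.
Qed.

(** The indices of the subprograms are hidden behind existentials, so that the arithmetic of codes
    does not enter the proofs about runs. *)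
Lemma step_run O n x K :
  match decode n with
  | CZero => step O (Some n, (x, K)) = (None, (0, K))
  | CSucc => step O (Some n, (x, K)) = (None, (S x, K))
  | CLeft => step O (Some n, (x, K)) = (None, (fst (Cantor.of_nat x), K))
  | CRight => step O (Some n, (x, K)) = (None, (snd (Cantor.of_nat x), K))
  | COracle => step O (Some n, (x, K)) = (None, (O x, K))
  | CPair f g => exists a b, f = decode a /\ g = decode b /\
      step O (Some n, (x, K)) = (Some a, (x, (0, (b, (x, (0, 0)))) :: K))
  | CComp f g => exists a b, f = decode a /\ g = decode b /\
      step O (Some n, (x, K)) = (Some b, (x, (2, (a, (0, (0, 0)))) :: K))
  | CPrec f g => exists a b, f = decode a /\ g = decode b /\
      step O (Some n, (x, K)) = (Some a, (fst (Cantor.of_nat x),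
         (3, (b, (fst (Cantor.of_nat x), (0, snd (Cantor.of_nat x))))) :: K))
  | CMin f => exists r, f = decode r /\
      step O (Some n, (x, K)) = (Some r, (⟨x, 0⟩, (4, (r, (x, (0, 0)))) :: K))
  end.
Proof.
  destruct (Nat.lt_ge_cases n 5) as [lt|ge].
  { do 5 (destruct n as [|n]; [reflexivity|]). lia. }
  pose proof (decode_ge5 (n - 5)) as Ed. cbv zeta in Ed.
  replace (5 + (n - 5)) with n in Ed by lia. rewrite Ed.
  unfold step, run_step. cbn [opt_elim fst snd].
  replace (n <? 5) with false by (symmetry; now apply Nat.ltb_ge).
  destruct (n - 5 - _) as [|[|[|t]]]; cbn [ite Nat.eqb]; eauto.
Qed.

Definition final (y : nat) : state := (None, (y, [])).

Lemma run_final O y t : run O t (final y) = final y.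
Proof.
  induction t as [|t IH]; [reflexivity|]. now rewrite run_S.
Qed.

Lemma run_complete O c : forall x y n K, decode n = c -> ev O c x y ->
  exists t, run O t (Some n, (x, K)) = (None, (y, K)).
Proof.
  induction c as [| | | | |f IHf g IHg|f IHf g IHg|f IHf g IHg|f IHf];
    intros x y n K Hn; pose proof (step_run O n x K) as Hs; rewrite Hn in Hs.
  1-5: intros Hy; simpl in Hy; subst y; exists 1; exact Hs.
  - destruct Hs as (a & b & Ef & Eg & Hs). intros (u & v & Hu & Hv & ->).
    destruct (IHf _ _ a ((0, (b, (x, (0, 0)))) :: K) (eq_sym Ef) Hu) as [t1 H1].
    destruct (IHg _ _ b ((1, (u, (0, (0, 0)))) :: K) (eq_sym Eg) Hv) as [t2 H2].
    exists (S (t1 + S (t2 + 1))).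
    now rewrite run_S, Hs, run_add, H1, run_S; cbn -[run]; rewrite run_add, H2.
  - destruct Hs as (a & b & Ef & Eg & Hs). intros (u & Hu & Hv).
    destruct (IHg _ _ b ((2, (a, (0, (0, 0)))) :: K) (eq_sym Eg) Hu) as [t1 H1].
    destruct (IHf _ _ a K (eq_sym Ef) Hv) as [t2 H2].
    exists (S (t1 + S t2)). now rewrite run_S, Hs, run_add, H1, run_S.
  - destruct Hs as (a & b & Ef & Eg & Hs). simpl.
    destruct (Cantor.of_nat x) as [p N]; cbn [fst snd] in *. intros Hy.
    (* Loop invariant: of [m + s] stages, [m] are done and [s] remain; [s] varies in the induction
       because each stage moves one unit across. *)
    assert (H : forall m s v, prec_graph (ev O f p) (fun m r => ev O g ⟨p, ⟨m, r⟩⟩) m v ->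
      exists t, run O t (Some a, (p, (3, (b, (p, (0, m + s)))) :: K))
                = (None, (v, (3, (b, (p, (m, s)))) :: K))).
    { induction m as [|m IH]; intros s v.
      - intros Hv. exact (IHf _ _ a _ (eq_sym Ef) Hv).
      - intros (r & Hr & Hv). destruct (IH (S s) r Hr) as [t1 H1].
        destruct (IHg _ _ b ((3, (b, (p, (S m, s)))) :: K) (eq_sym Eg) Hv) as [t2 H2].
        exists (t1 + S t2). replace (S m + s) with (m + S s) by lia.
        now rewrite run_add, H1, run_S. }
    destruct (H N 0 y Hy) as [t Ht]. exists (S (t + 1)). rewrite Nat.add_0_r in Ht.
    now rewrite run_S, Hs, run_add, Ht.
  - destruct Hs as (a & Ef & Hs). intros [H0 H1].
    (* All candidates below [m] fail, so the loop reaches candidate [m]. *)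
    assert (H : forall m, m <= y ->
      exists t, run O t (Some a, (⟨x, 0⟩, (4, (a, (x, (0, 0)))) :: K))
                = (Some a, (⟨x, m⟩, (4, (a, (x, (m, 0)))) :: K))).
    { induction m as [|m IH]; intros Hm; [now exists 0|].
      destruct IH as [t1 IH]; [lia|]. destruct (H1 m Hm) as [k Hk].
      destruct (IHf _ _ a ((4, (a, (x, (m, 0)))) :: K) (eq_sym Ef) Hk) as [t2 H2].
      exists (t1 + (t2 + 1)). now rewrite run_add, IH, run_add, H2. }
    destruct (H y (le_n y)) as [t1 Ht1].
    destruct (IHf _ _ a ((4, (a, (x, (y, 0)))) :: K) (eq_sym Ef) H0) as [t2 H2].
    exists (S (t1 + (t2 + 1))). now rewrite run_S, Hs, run_add, Ht1, run_add, H2.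
Qed.

(** Induction on the running time: loops restart the same subprogram, but with less time left. The
    bound [t' < t] is what feeds the induction when a value comes back to the stack. *)
Lemma run_sound O z : forall t n x K, run O t (Some n, (x, K)) = final z ->
  exists v t', t' < t /\ ev O (decode n) x v /\ run O t' (None, (v, K)) = final z.
Proof.
  induction t as [t IH] using lt_wf_ind. intros n x K Ht.
  destruct t as [|t]; [discriminate Ht|].
  (* A state with a nonempty stack is not final, so at least one more step was made. *)
  assert (ret : forall t1 v fr, run O t1 (None, (v, fr :: K)) = final z ->
    exists t2, t1 = S t2 /\ run O t2 (ret_step v fr K) = final z).
  { intros [|t1] v fr H; [discriminate H|]. exists t1. split; [reflexivity|].
    rewrite run_S in H. exact H. }
  pose proof (step_run O n x K) as Hs. rewrite run_S in Ht.
  destruct (decode n) as [| | | | |f g|f g|f g|f] eqn:En.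
  1-5: rewrite Hs in Ht; eexists _, t; (split; [lia|]); split; [|exact Ht]; reflexivity.
  - destruct Hs as (a & b & -> & -> & Hs). rewrite Hs in Ht.
    apply IH in Ht as (u & t1 & L1 & Hu & H1); [|lia].
    apply ret in H1 as (t2 & -> & H2). cbn -[run] in H2.
    apply IH in H2 as (v & t3 & L3 & Hv & H3); [|lia].
    apply ret in H3 as (t4 & -> & H4). cbn -[run] in H4.
    exists ⟨u, v⟩, t4. split; [lia|]. split; [now apply ev_pair|exact H4].
  - destruct Hs as (a & b & -> & -> & Hs). rewrite Hs in Ht.
    apply IH in Ht as (u & t1 & L1 & Hu & H1); [|lia].
    apply ret in H1 as (t2 & -> & H2). cbn -[run] in H2.
    apply IH in H2 as (v & t3 & L3 & Hv & H3); [|lia].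
    exists v, t3. split; [lia|]. split; [now exists u|exact H3].
  - destruct Hs as (a & b & -> & -> & Hs). rewrite Hs in Ht. simpl.
    destruct (Cantor.of_nat x) as [p N]; cbn [fst snd] in *.
    apply IH in Ht as (u & t1 & L1 & Hu & H1); [|lia].
    set (P := prec_graph (ev O (decode a) p) (fun m r => ev O (decode b) ⟨p, ⟨m, r⟩⟩)).
    enough (H : forall s m v t1, t1 <= t -> P m v ->
      run O t1 (None, (v, (3, (b, (p, (m, s)))) :: K)) = final z ->
      exists w t2, t2 < S t /\ P (m + s) w /\ run O t2 (None, (w, K)) = final z).
    { exact (H N 0 u t1 ltac:(lia) Hu H1). }
    clear u t1 L1 Hu H1.
    induction s as [|s IHs]; intros m v t1 L1 Hv H1;
      apply ret in H1 as (t2 & -> & H2); cbn -[run] in H2.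
    + exists v, t2. rewrite Nat.add_0_r. split; [lia|]. auto.
    + apply IH in H2 as (w & t3 & L3 & Hw & H3); [|lia].
      replace (m + S s) with (S m + s) by lia. apply (IHs (S m) w t3); [lia| |exact H3].
      now exists v.
  - destruct Hs as (a & -> & Hs). rewrite Hs in Ht. simpl.
    enough (H : forall t1 m, t1 <= t ->
      (forall k, k < m -> exists v, ev O (decode a) ⟨x, k⟩ (S v)) ->
      run O t1 (Some a, (⟨x, m⟩, (4, (a, (x, (m, 0)))) :: K)) = final z ->
      exists w t2, t2 < S t /\ (ev O (decode a) ⟨x, w⟩ 0 /\
        forall k, k < w -> exists v, ev O (decode a) ⟨x, k⟩ (S v)) /\
      run O t2 (None, (w, K)) = final z).
    { apply (H t 0); [lia|intros; lia|exact Ht]. }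
    clear Ht. induction t1 as [t1 IHt] using lt_wf_ind. intros m L1 Hm H1.
    apply IH in H1 as (v & t2 & L2 & Hv & H2); [|lia].
    apply ret in H2 as (t3 & -> & H3). cbn -[run] in H3.
    destruct v as [|v]; cbn -[run] in H3.
    + exists m, t3. split; [lia|]. auto.
    + apply (IHt t3) in H3; [exact H3|lia|lia|].
      intros k Hk. destruct (Nat.eq_dec k m) as [->|ne]; [now exists v|apply Hm; lia].
Qed.

Definition bounded (O : nat -> nat) (e x t : nat) : option nat :=
  let s := run O t (Some e, (x, [])) in
  opt_elim (list_elim (Some (fst (snd s))) (fun _ _ => None) (snd (snd s)))
    (fun _ => None) (fst s).

Lemma bounded_Some O e x t y :
  bounded O e x t = Some y <-> run O t (Some e, (x, [])) = final y.
Proof.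
  unfold bounded. destruct (run O t _) as [[n|] [v [|fr K]]]; simpl; unfold final;
    split; congruence.
Qed.

Lemma ev_bounded O e x y : ev O (decode e) x y <-> exists t, bounded O e x t = Some y.
Proof.
  split.
  - intros H. destruct (run_complete O _ x y e [] eq_refl H) as [t Ht].
    exists t. now apply bounded_Some.
  - intros [t Ht]. apply bounded_Some in Ht.
    apply run_sound in Ht as (v & t' & _ & Hv & Ht').
    change (None, (v, [])) with (final v) in Ht'. rewrite run_final in Ht'.
    injection Ht' as ->. exact Hv.
Qed.

Lemma effective_bounded :
  effective (fun O (p : nat * (nat * nat)) => bounded O (fst p) (fst (snd p)) (snd (snd p))).
Proof.
  assert (H : effective (fun O (p : nat * (nat * nat)) =>
    run O (snd (snd p)) (Some (fst p), (fst (snd p), [])))).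
  { unfold run. eff. unfold step, run_step, ret_step. eff. }
  unfold bounded. eff; exact H || exact (effective_comp _ _ H (effective_fst _ effective_id)).
Qed.

Lemma effective_bounded_app {A} {EA : Enc A} (f g k : (nat -> nat) -> A -> nat) :
  effective f -> effective g -> effective k ->
  effective (fun O a => bounded O (f O a) (g O a) (k O a)).
Proof.
  intros Hf Hg Hk.
  exact (effective_comp _ _ effective_bounded (effective_pair _ _ Hf (effective_pair _ _ Hg Hk))).
Qed.

Definition bounded0 : nat -> nat -> nat -> option nat := bounded (fun _ => 0).

(** Answering all queries by 0 makes the evaluator independent of the oracle it runs under. *)
Lemma eff_bounded0 : eff3 bounded0.
Proof.
  unfold eff3, bounded0.
  apply (effective_subst (fun O (p : nat * (nat * nat)) => bounded O (fst p) (fst (snd p)) (snd (snd p)))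
           (fun _ _ _ => 0)); [apply effective_bounded|eff].
Qed.
#[export] Hint Resolve eff_bounded0 : eff.

Definition outputs (e x y t : nat) : bool :=
  opt_elim false (fun v => v =? y) (bounded0 e x t).

Lemma phi0_outputs e x y : phi0 e x y <-> exists t, outputs e x y t = true.
Proof.
  unfold phi0, phi. rewrite ev_bounded.
  split; intros [t Ht]; exists t; unfold outputs, bounded0 in *.
  - cbn in Ht |- *. rewrite Ht. apply Nat.eqb_refl.
  - cbn in Ht |- *. destruct (bounded _ _ _ _) as [v|]; [|discriminate Ht].
    now apply Nat.eqb_eq in Ht as ->.
Qed.

(** * Computable functions and the s-m-n theorem *)

Definition orc (D : nat -> bool) : nat -> nat := fun n => Nat.b2n (D n).

Lemma eff1_computable (f : nat -> nat) : eff1 f <-> computable_fun f.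
Proof.
  split.
  - intros [c Hc]. exists (encode c). intros x. unfold phi0, phi. rewrite decodeK.
    apply (Hc _ x).
  - intros [e He]. exists (CComp (csubst CZero (decode e)) (CPair CZero cid)). intros O x.
    apply (ev_comp _ _ _ _ ⟨0, x⟩); [apply ev_pair; [reflexivity|apply ev_cid]|].
    apply (ev_csubst O (fun _ => 0)); [reflexivity|]. apply He.
Qed.

Lemma eff2_computable (f : nat -> nat -> nat) : eff2 f <-> computable_fun2 f.
Proof.
  split.
  - intros [c Hc]. exists (encode c). intros x y. unfold phi0, phi. rewrite decodeK.
    apply (Hc _ (x, y)).
  - intros [e He]. exists (CComp (csubst CZero (decode e)) (CPair CZero cid)). intros O p.
    apply (ev_comp _ _ _ _ ⟨0, enc p⟩); [apply ev_pair; [reflexivity|apply ev_cid]|].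
    apply (ev_csubst O (fun _ => 0)); [reflexivity|]. destruct p. apply He.
Qed.

(** The argument [a] is hard-wired as a constant program; only the index of that constant varies
    with [a]. *)
Lemma smn (c : code) : exists g, eff1 g /\
  forall O a x y, ev O (decode (g a)) x y <-> ev O c ⟨a, x⟩ y.
Proof.
  exists (fun a => encode (CComp c (CPair (cconst a) cid))). split.
  - set (h := fun a => encode (cconst a)). assert (H : eff1 h).
    (* The recursion follows [encode] on [CComp CSucc _], where 1 is the code of [CSucc]. *)
    { apply (eff_ext1 (nrec 0 (fun _ r => 5 + (1 + ⟨1, r⟩ * 4)))); [|eff].
      induction a as [|a IH]; [reflexivity|].
      change (h (S a)) with (5 + (1 + ⟨1, h a⟩ * 4)). now rewrite <- IH. }
    apply (eff_ext1 (fun a => 5 + (1 + ⟨encode c, 5 + ⟨h a, encode cid⟩ * 4⟩ * 4)));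
      [reflexivity|eff].
  - intros O a x y. rewrite decodeK. apply ev_comp, ev_pair; [apply ev_cconst|apply ev_cid].
Qed.

Lemma index_total (H : nat -> nat -> nat) : eff2 H ->
  exists g, eff1 g /\ forall n z, phi0 (g n) z (H n z).
Proof.
  intros [c Hc]. destruct (smn c) as (g & Hg & Hev). exists g. split; [exact Hg|].
  intros n z. apply Hev. apply (Hc _ (n, z)).
Qed.

(** * Sets enumerated by an oracle *)

(** A total test with a stage [t] replaces the domain of a program, so closure properties reduce to
    [eff]; [ce_in_ce] compares the two. *)
Definition ce (O : nat -> nat) {A} {EA : Enc A} (S : A -> Prop) : Prop :=
  exists F, effective F /\ forall a, S a <-> exists t : nat, F O (a, t) = true.

Section Enumerable.
Context (O : nat -> nat) {A : Type} {EA : Enc A}.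

Lemma ce_iff (S T : A -> Prop) : (forall a, S a <-> T a) -> ce O S -> ce O T.
Proof. intros H (F & HF & E). exists F. split; [exact HF|]. intros a. now rewrite <- H. Qed.

Lemma ce_dec (b : (nat -> nat) -> A -> bool) : effective b -> ce O (fun a => b O a = true).
Proof.
  intros Hb. exists (fun O p => b O (fst p)). split.
  - eff.
  - intros a. split; [now exists 0|now intros [t H]].
Qed.

Lemma ce_comp {B} {EB : Enc B} (S : B -> Prop) (h : (nat -> nat) -> A -> B) :
  ce O S -> effective h -> ce O (fun a => S (h O a)).
Proof.
  intros (F & HF & E) Hh. exists (fun O p => F O (h O (fst p), snd p)). split.
  - eff.
  - intros a. apply E.
Qed.

Lemma ce_and (S T : A -> Prop) : ce O S -> ce O T -> ce O (fun a => S a /\ T a).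
Proof.
  intros (F & HF & E) (G & HG & E').
  exists (fun O p => F O (fst p, fst (Cantor.of_nat (snd p)))
                  && G O (fst p, snd (Cantor.of_nat (snd p)))). split.
  - eff.
  - intros a. rewrite E, E'. split.
    + intros [[t Ht] [u Hu]]. exists ⟨t, u⟩. cbn [fst snd].
      rewrite Cantor.cancel_of_to. cbn [fst snd]. now rewrite Ht, Hu.
    + intros [t Ht]. apply andb_prop in Ht as [H1 H2]. eauto.
Qed.

Lemma ce_ex (S : A -> nat -> Prop) :
  ce O (fun p => S (fst p) (snd p)) -> ce O (fun a => exists y, S a y).
Proof.
  intros (F & HF & E).
  exists (fun O p => F O ((fst p, fst (Cantor.of_nat (snd p))), snd (Cantor.of_nat (snd p)))).
  split; [eff|].
  intros a. split.
  - intros [y Hy]. apply (E (a, y)) in Hy as [t Ht]. exists ⟨y, t⟩. cbn [fst snd].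
    now rewrite Cantor.cancel_of_to.
  - intros [z Hz]. exists (fst (Cantor.of_nat z)). apply (E (a, _)). eauto.
Qed.

Lemma ce_imp (b : (nat -> nat) -> A -> bool) (S : A -> Prop) :
  effective b -> ce O S -> ce O (fun a => b O a = true -> S a).
Proof.
  intros Hb (F & HF & E). exists (fun O p => implb (b O (fst p)) (F O p)). split.
  - eff.
  - intros a. cbn [fst]. destruct (b O a); simpl.
    + rewrite <- E. split; auto.
    + split; [now exists 0|discriminate].
Qed.
End Enumerable.

Lemma ce_ev O : ce O (fun p : nat * nat * nat => ev O (decode (fst (fst p))) (snd (fst p)) (snd p)).
Proof.
  exists (fun O p => opt_elim false (fun v => v =? snd (fst p))
     (bounded O (fst (fst (fst p))) (snd (fst (fst p))) (snd p))).
  split; [eff; apply effective_bounded_app; eff|].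
  intros [[e x] y]. cbn [fst snd]. rewrite ev_bounded. split; intros [t Ht]; exists t.
  - rewrite Ht. apply Nat.eqb_refl.
  - destruct (bounded O e x t) as [v|]; [|discriminate Ht].
    now apply Nat.eqb_eq in Ht as ->.
Qed.

Lemma ce_phi0 O : ce O (fun p : nat * nat * nat => phi0 (fst (fst p)) (snd (fst p)) (snd p)).
Proof.
  exists (fun O p => outputs (fst (fst (fst p))) (snd (fst (fst p))) (snd (fst p)) (snd p)).
  split; [unfold outputs; eff|]. intros p. apply phi0_outputs.
Qed.

(** The program looks for the least code of a value together with a stage confirming it, and then
    drops the stage. *)
Lemma ce_uniformize O {A} {EA : Enc A} (S : A * nat -> Prop) : ce O S ->
  exists c, (forall a y, ev O c (enc a) y -> S (a, y)) /\
    forall a, (exists y, S (a, y)) -> exists y, ev O c (enc a) y.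
Proof.
  intros (F & HF & E).
  destruct (effective_search (fun O a z =>
    F O ((a, fst (Cantor.of_nat z)), snd (Cantor.of_nat z)))) as [c Hc].
  { eff. }
  exists (CComp CLeft c). split.
  - intros a y (z & Hz & ->). apply Hc in Hz as [Hz _]. apply E. eauto.
  - intros a [y Hy]. apply E in Hy as [t Ht].
    assert (H : exists z, F O ((a, fst (Cantor.of_nat z)), snd (Cantor.of_nat z)) = true).
    { exists ⟨y, t⟩. now rewrite Cantor.cancel_of_to. }
    apply (dec_inh_nat_subset_has_unique_least_element _
      (fun z => classic _)) in H as (z & [Hz Hmin] & _).
    exists (fst (Cantor.of_nat z)), z. split; [|reflexivity].
    apply Hc. split; [exact Hz|]. intros m Hm.
    apply not_true_iff_false. intros Em. specialize (Hmin m Em). lia.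
Qed.

Lemma ce_in_ce D (A : nat -> Prop) : ce_in D A <-> ce (orc D) A.
Proof.
  split.
  - intros [e He]. apply (ce_iff _ (fun n => exists y, ev (orc D) (decode e) n y)).
    { intros n. now rewrite He. }
    apply ce_ex. apply (ce_comp _ _ (fun _ p => ((e, fst p), snd p)) (ce_ev (orc D))). eff.
  - intros H. destruct (ce_uniformize (orc D) (fun p : nat * nat => A (fst p)))
      as (c & H1 & H2).
    { apply (ce_comp _ _ (fun _ p => fst p) H). eff. }
    exists (encode c). intros n. unfold phi. rewrite decodeK. split.
    + intros Hn. apply (H2 n). now exists 0.
    + intros [y Hy]. exact (H1 n y Hy).
Qed.

(** Queries to [D] are answered by the program [d] with oracle [D']; the 0 paired to the input is a
    dummy for the parameter of [csubst]. *)
Lemma ce_in_turing_le D D' A : turing_le D D' -> ce_in D A -> ce_in D' A.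
Proof.
  intros [d Hd] [e He].
  exists (encode (CComp (csubst (CComp (decode d) CRight) (decode e)) (CPair CZero cid))).
  intros n. rewrite He. unfold phi. rewrite decodeK.
  assert (H : forall y, ev (fun n => Nat.b2n (D' n))
    (CComp (csubst (CComp (decode d) CRight) (decode e)) (CPair CZero cid)) n y
    <-> ev (fun n => Nat.b2n (D n)) (decode e) n y).
  { intros y. rewrite (ev_comp _ _ _ _ ⟨0, n⟩)
      by (apply ev_pair; [reflexivity|apply ev_cid]).
    apply ev_csubst. intros k. apply (ev_comp _ _ _ _ k); [now apply ev_right|apply Hd]. }
  split; intros [y Hy]; exists y; now apply H.
Qed.

Lemma turing_le_refl D : turing_le D D.
Proof. exists (encode COracle). intros x. unfold phi. now rewrite decodeK. Qed.

(** Recursion over two searches. Each value is found only after it is confirmed, and a later value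
    only after all earlier ones; a search without solution diverges. Thus any output certifies the
    initial condition, which is the source of reticence. *)
Lemma ce_dependent_choice O (Q0 : nat * nat -> Prop) (Q : nat * (nat * nat) * nat -> Prop) :
  ce O Q0 -> ce O Q ->
  exists c,
    (forall n y, ev O c ⟨n, 0⟩ y -> Q0 (n, y)) /\
    (forall n m y, ev O c ⟨n, S m⟩ y -> exists r, ev O c ⟨n, m⟩ r /\ Q ((n, (m, r)), y)) /\
    (forall n, (exists y, Q0 (n, y)) -> exists y, ev O c ⟨n, 0⟩ y) /\
    (forall n m r, ev O c ⟨n, m⟩ r -> (exists y, Q ((n, (m, r)), y)) ->
       exists y, ev O c ⟨n, S m⟩ y).
Proof.
  intros H0 H. apply ce_uniformize in H0 as (c0 & S0 & T0).
  apply ce_uniformize in H as (c1 & S1 & T1). exists (CPrec c0 c1).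
  cbn [ev]. repeat split; intros n; try intros m; rewrite ?Cantor.cancel_of_to; cbn [fst snd prec_graph].
  - apply S0.
  - intros y (r & Hr & Hy). exists r. split; [exact Hr|].
    exact (S1 (n, (m, r)) y Hy).
  - apply T0, m.
  - intros r Hr He. apply (T1 (n, (m, r))) in He as [y Hy]. exists y, r. split; [exact Hr|exact Hy].
Qed.

Lemma choice {A B} (R : A -> B -> Prop) :
  (forall x, exists y, R x y) -> exists f, forall x, R x (f x).
Proof.
  intros H. exists (fun x => proj1_sig (constructive_indefinite_description _ (H x))).
  intros x. apply proj2_sig.
Qed.

(** * Π⁰₂ predicates of functions *)

(** Every clause saying that [X] codes a path, an order, a structure or an isomorphism has this
    form, and the closure lemmas below check it clause by clause. *)
Definition pi2 {A} {EA : Enc A} (P : (nat -> nat) -> A -> Prop) : Prop :=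
  exists F, effective F /\
    forall X a, P X a <-> forall m : nat, exists k : nat, F X (a, (m, k)) = true.

Section Pi2.
Context {A : Type} {EA : Enc A}.

Lemma pi2_iff (P Q : (nat -> nat) -> A -> Prop) :
  (forall X a, P X a <-> Q X a) -> pi2 P -> pi2 Q.
Proof. intros H (F & HF & E). exists F. split; [exact HF|]. intros. now rewrite <- H. Qed.

Lemma pi2_ex (b : (nat -> nat) -> A -> nat -> bool) :
  effective (fun X p => b X (fst p) (snd p)) -> pi2 (fun X a => exists k, b X a k = true).
Proof.
  intros Hb. exists (fun X p => b X (fst p) (snd (snd p))). split.
  - eff.
  - intros X a. split; [auto|]. intros H. exact (H 0).
Qed.

Lemma pi2_dec (b : (nat -> nat) -> A -> bool) :
  effective b -> pi2 (fun X a => b X a = true).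
Proof.
  intros Hb. apply (pi2_iff (fun X a => exists k : nat, b X a = true)).
  - intros X a. split; [now intros [k H]|now exists 0].
  - apply (pi2_ex (fun X a _ => b X a)).
    eff.
Qed.

Lemma pi2_all (P : (nat -> nat) -> A -> nat -> Prop) :
  pi2 (fun X p => P X (fst p) (snd p)) -> pi2 (fun X a => forall m, P X a m).
Proof.
  intros (F & HF & E).
  exists (fun X p => F X ((fst p, fst (Cantor.of_nat (fst (snd p)))),
                          (snd (Cantor.of_nat (fst (snd p))), snd (snd p)))).
  split; [eff|].
  intros X a. split.
  - intros H m. cbn [fst snd]. apply (E X (a, _)), H.
  - intros H m. apply (E X (a, m)). intros k. specialize (H ⟨m, k⟩). cbn [fst snd] in H.
    now rewrite Cantor.cancel_of_to in H.
Qed.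

Lemma pi2_and (P Q : (nat -> nat) -> A -> Prop) :
  pi2 P -> pi2 Q -> pi2 (fun X a => P X a /\ Q X a).
Proof.
  intros (F & HF & E) (G & HG & E').
  exists (fun X p => ite (fst (Cantor.of_nat (fst (snd p))) =? 0)
    (F X (fst p, (snd (Cantor.of_nat (fst (snd p))), snd (snd p))))
    (G X (fst p, (snd (Cantor.of_nat (fst (snd p))), snd (snd p))))).
  split.
  { eff. }
  intros X a. rewrite E, E'. cbn [fst snd]. split.
  - intros [H H'] m. destruct (_ =? 0); cbn [ite]; auto.
  - intros H. split; intros m; [specialize (H ⟨0, m⟩)|specialize (H ⟨1, m⟩)];
      now rewrite Cantor.cancel_of_to in H.
Qed.

Lemma pi2_imp (b : (nat -> nat) -> A -> bool) (P : (nat -> nat) -> A -> Prop) :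
  effective b -> pi2 P -> pi2 (fun X a => b X a = true -> P X a).
Proof.
  intros Hb (F & HF & E). exists (fun X p => implb (b X (fst p)) (F X p)). split.
  - eff.
  - intros X a. cbn [fst]. destruct (b X a); simpl.
    + rewrite <- E. split; auto.
    + split; [now exists 0|discriminate].
Qed.

Lemma pi2_subst (P : (nat -> nat) -> A -> Prop) (G : (nat -> nat) -> A -> nat -> nat) :
  pi2 P -> effective (fun X p => G X (fst p) (snd p)) -> pi2 (fun X a => P (G X a) a).
Proof.
  intros (F & HF & E) HG. exists (fun X p => F (G X (fst p)) p). split.
  - apply (effective_subst F (fun X p => G X (fst p)) HF).
    eff.
  - intros X a. apply E.
Qed.

Lemma pi2_phi0 (f g h : (nat -> nat) -> A -> nat) :
  effective f -> effective g -> effective h ->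
  pi2 (fun X a => phi0 (f X a) (g X a) (h X a)).
Proof.
  intros Hf Hg Hh.
  apply (pi2_iff (fun X a => exists t, outputs (f X a) (g X a) (h X a) t = true)).
  { intros X a. now rewrite phi0_outputs. }
  apply pi2_ex. unfold outputs.
  eff.
Qed.

Lemma pi2_comp {B} {EB : Enc B} (P : (nat -> nat) -> B -> Prop) (h : (nat -> nat) -> A -> B) :
  pi2 P -> effective h -> pi2 (fun X a => P X (h X a)).
Proof.
  intros (F & HF & E) Hh. exists (fun X p => F X (h X (fst p), snd p)). split.
  - eff.
  - intros X a. apply E.
Qed.
End Pi2.

(** * From Π⁰₂ predicates to trees *)

Lemma length_initseg X m : length (initseg X m) = m.
Proof. unfold initseg. now rewrite length_map, length_seq. Qed.

Lemma nth_initseg X m k d : k < m -> nth k (initseg X m) d = X k.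
Proof.
  intros H. unfold initseg. rewrite (nth_indep _ d (X 0)) by now rewrite length_map, length_seq.
  now rewrite map_nth, seq_nth.
Qed.

Lemma initseg_S X m : initseg X (S m) = initseg X m ++ [X m].
Proof. unfold initseg. now rewrite seq_S, map_app. Qed.

(* A branch Y of the tree carries X together with bounds on the existential
   witnesses; X k and the bound at k are the two components of Y k. *)
Lemma pi2_tree (P : (nat -> nat) -> nat -> Prop) : pi2 P ->
  exists T : nat -> list nat -> bool, eff2 T /\ forall n,
    (forall Y, (forall m, T n (initseg Y m) = true) ->
       P (fun k => fst (Cantor.of_nat (Y k))) n) /\
    (forall X, P X n -> exists Y, forall m, T n (initseg Y m) = true).
Proof.
  intros (F & HF & E).
  set (look := fun (s : list nat) k => fst (Cantor.of_nat (nth k s 0))).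
  set (wit := fun (s : list nat) k => snd (Cantor.of_nat (nth k s 0))).
  (* Entry [k] is checked only once the string is as long as its bound [wit s k]. The oracle
     [look s] is [s] padded with zeros, and the double negation of [forallb] is a bounded search for
     the witness. *)
  set (T := fun n s => forallb (fun k => implb (wit s k <=? length s)
    (negb (forallb (fun j => negb (F (look s) (n, (k, j)))) (seq 0 (S (wit s k))))))
    (seq 0 (length s))).
  exists T. split.
  { unfold eff2, T, wit. eff.
    apply (effective_subst
      (fun O (p : nat * list nat * nat * nat) => F O (fst (fst (fst p)), (snd (fst p), snd p)))
      (fun _ p => look (snd (fst (fst p))))).
    - eff.
    - unfold look. eff. }
  assert (HT : forall n Y, (forall m, T n (initseg Y m) = true) <->
    forall m k, k < m -> snd (Cantor.of_nat (Y k)) <= m ->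
      exists j, j <= snd (Cantor.of_nat (Y k)) /\ F (look (initseg Y m)) (n, (k, j)) = true).
  { intros n Y.
    assert (Hm : forall m, T n (initseg Y m) = true <-> forall k, k < m -> snd (Cantor.of_nat (Y k)) <= m ->
      exists j, j <= snd (Cantor.of_nat (Y k)) /\ F (look (initseg Y m)) (n, (k, j)) = true).
    { intros m. unfold T. rewrite forallb_forall, length_initseg. split.
      - intros H k Hk Hw. specialize (H k). unfold wit in H. rewrite nth_initseg in H by exact Hk.
        rewrite (proj2 (Nat.leb_le _ _) Hw) in H. cbn [implb] in H.
        apply NNPP. intros Hn. assert (H' := H ltac:(apply in_seq; lia)).
        apply negb_true_iff in H'. apply Bool.not_true_iff_false in H'. apply H'.
        apply forallb_forall. intros j Hj. apply in_seq in Hj. apply negb_true_iff.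
        apply Bool.not_true_iff_false. intros Hf. apply Hn. exists j. split; [lia|exact Hf].
      - intros H k Hk. apply in_seq in Hk. unfold wit. rewrite nth_initseg by lia.
        destruct (Nat.leb_spec (snd (Cantor.of_nat (Y k))) m) as [le|]; [|reflexivity].
        cbn [implb]. destruct (H k ltac:(lia) le) as (j & Hj & Hf). apply negb_true_iff.
        apply Bool.not_true_iff_false. intros H'. rewrite forallb_forall in H'.
        specialize (H' j ltac:(apply in_seq; lia)). now rewrite Hf in H'. }
    split; intros H m; apply Hm, H. }
  intros n. split.
  - intros Y HY. rewrite HT in HY. apply E. intros k.
    set (w := snd (Cantor.of_nat (Y k))). set (X := fun k => fst (Cantor.of_nat (Y k))).
    (* Beyond a common use for all witnesses up to the bound, the padded string is as good as [X]
       itself. *)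
    assert (use : forall w, exists u, forall X' j, (forall i, i < u -> X' i = X i) -> j <= w ->
      F X' (n, (k, j)) = F X (n, (k, j))).
    { clear -HF. induction w as [|w [u Hu]].
      - destruct (effective_use F HF X (n, (k, 0))) as [u Hu]. exists u.
        intros X' j HX Hj. replace j with 0 by lia. auto.
      - destruct (effective_use F HF X (n, (k, S w))) as [u' Hu']. exists (max u u').
        intros X' j HX Hj. destruct (Nat.eq_dec j (S w)) as [->|ne].
        + apply Hu'. intros i Hi. apply HX. lia.
        + apply Hu; [intros i Hi; apply HX|]; lia. }
    destruct (use w) as [u Hu].
    destruct (HY (S (k + w + u)) k) as (j & Hj & Hf); [lia|fold w; lia|].
    exists j. rewrite <- Hf. symmetry. apply Hu; [|exact Hj].
    intros i Hi. unfold look. now rewrite nth_initseg by lia.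
  (* The bound is taken at least as large as a witness and its use, so that every string that has to
     be checked already contains what the test reads. *)
  - intros X HX. rewrite E in HX.
    assert (HW : forall k, exists w, exists j, j <= w /\
      forall X', (forall i, i < w -> X' i = X i) -> F X' (n, (k, j)) = true).
    { intros k. destruct (HX k) as [j Hj].
      destruct (effective_use F HF X (n, (k, j))) as [u Hu]. exists (max u j), j.
      split; [lia|]. intros X' H. rewrite <- Hj. apply Hu. intros i Hi. apply H. lia. }
    apply choice in HW as [w Hw].
    exists (fun k => ⟨X k, w k⟩). apply HT. intros m k Hk.
    rewrite Cantor.cancel_of_to. cbn [snd]. intros Hm.
    destruct (Hw k) as (j & Hj & Hf). exists j. split; [exact Hj|]. apply Hf.
    intros i Hi. unfold look. rewrite nth_initseg by lia. now rewrite Cantor.cancel_of_to.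
Qed.

Lemma Sigma11_tree (T : nat -> list nat -> bool) : eff2 T ->
  Sigma11 (fun n => exists Y, forall m, T n (initseg Y m) = true).
Proof.
  intros [c Hc]. exists T. split; [|reflexivity]. exists (encode c). intros n s.
  unfold phi0, phi. rewrite decodeK. apply (Hc _ (n, s)).
Qed.

Lemma Sigma11_pi2 (P : (nat -> nat) -> nat -> Prop) : pi2 P ->
  Sigma11 (fun n => exists X, P X n).
Proof.
  intros H. destruct (pi2_tree P H) as (T & HT & HP).
  destruct (Sigma11_tree T HT) as (R & HR & E). exists R. split; [exact HR|].
  intros n. rewrite <- E. destruct (HP n) as [H1 H2].
  split; [intros [X HX]; eauto|intros [Y HY]; eauto].
Qed.

Lemma Sigma11_eff (A : nat -> Prop) : Sigma11 A ->
  exists T : nat -> list nat -> bool, eff2 T /\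
    forall n, A n <-> exists X, forall m, T n (initseg X m) = true.
Proof.
  intros (R & [e He] & HA). exists R. split; [|exact HA].
  exists (CComp (csubst CZero (decode e)) (CPair CZero cid)). intros O [n s].
  apply (ev_comp _ _ _ _ ⟨0, enc (n, s)⟩); [apply ev_pair; [reflexivity|apply ev_cid]|].
  apply (ev_csubst O (fun _ => 0)); [reflexivity|]. apply He.
Qed.

(** * Computing solutions from an enumeration of the Σ¹₁ sets *)

Section Basis.
Variable O : nat -> nat.
Hypothesis O_enum : forall A : nat -> Prop, Sigma11 A -> ce O A.

(** The set [ext] of extendible strings is Σ¹₁, hence enumerable, and each of its members has a
    one-step extension in it. [ext n s] speaks of [s] and longer strings only; that the shorter ones
    lie in [T n] is known from the earlier choices. *)
Lemma tree_basis (T : nat -> list nat -> bool) : eff2 T ->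
  exists c, forall n,
    ((exists Y, forall m, T n (initseg Y m) = true) ->
       exists Y, (forall m, T n (initseg Y m) = true) /\ forall k, ev O c ⟨n, k⟩ (Y k)) /\
    (forall k y, ev O c ⟨n, k⟩ y -> exists Y, forall m, T n (initseg Y m) = true).
Proof.
  intros HT.
  set (ext := fun n s => exists Z, forall m, T n (s ++ initseg Z m) = true).
  assert (Hext : ce O (fun p => ext (fst (Cantor.of_nat p)) (seqdec (snd (Cantor.of_nat p))))).
  { apply O_enum. apply (Sigma11_tree (fun p s =>
      T (fst (Cantor.of_nat p)) (seqdec (snd (Cantor.of_nat p)) ++ s))). eff. }
  assert (Hext' : forall n s, ext n s -> exists x, ext n (s ++ [x])).
  { intros n s [Z HZ]. exists (Z 0), (fun k => Z (S k)). intros m.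
    rewrite <- app_assoc. replace ([Z 0] ++ _) with (initseg Z (S m)); [apply HZ|].
    unfold initseg. simpl. f_equal. now rewrite <- seq_shift, map_map. }
  assert (ext_T : forall n s, ext n s -> T n s = true).
  { intros n s [Z HZ]. rewrite <- (HZ 0). f_equal. now rewrite app_nil_r. }
  destruct (ce_dependent_choice O
    (fun p => snd p = 0 /\ ext (fst p) [])
    (fun p => ext (fst (fst p)) (seqdec (snd p)) /\
              exists x, snd p = seqcode (seqdec (snd (snd (fst p))) ++ [x])))
    as (c & S0 & S1 & T0 & T1).
  - apply ce_and.
    + apply (ce_iff _ (fun p : nat * nat => (snd p =? 0) = true)).
      { intros p. apply Nat.eqb_eq. }
      apply (ce_dec O (fun _ p => snd p =? 0)). eff.
    + apply (ce_iff _ (fun p : nat * nat =>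
        ext (fst (Cantor.of_nat ⟨fst p, 0⟩)) (seqdec (snd (Cantor.of_nat ⟨fst p, 0⟩))))).
      { intros p. now rewrite Cantor.cancel_of_to. }
      apply (ce_comp O _ (fun _ p => ⟨fst p, 0⟩) Hext). eff.
  - apply ce_and.
    + apply (ce_iff _ (fun p : nat * (nat * nat) * nat =>
        ext (fst (Cantor.of_nat ⟨fst (fst p), snd p⟩))
            (seqdec (snd (Cantor.of_nat ⟨fst (fst p), snd p⟩))))).
      { intros p. now rewrite Cantor.cancel_of_to. }
      apply (ce_comp O _ (fun _ p => ⟨fst (fst p), snd p⟩) Hext). eff.
    + apply ce_ex.
      apply (ce_iff _ (fun p : nat * (nat * nat) * nat * nat =>
        (snd (fst p) =? seqcode (seqdec (snd (snd (fst (fst p)))) ++ [snd p])) = true)).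
      { intros p. apply Nat.eqb_eq. }
      apply (ce_dec O (fun _ p => snd (fst p) =? seqcode (seqdec (snd (snd (fst (fst p)))) ++ [snd p]))). eff.
  - assert (Hc : forall n m r, ev O c ⟨n, m⟩ r -> ext n (seqdec r)).
    { intros n [|m] r Hr.
      - apply S0 in Hr as [E H]. cbn in E, H. now rewrite E.
      - apply S1 in Hr as (r' & _ & H & _). exact H. }
    (* Stage [m] of [c] gives the string of length [m], so the value at [k] is the last entry at
       stage [S k]. *)
    assert (Hpost : eff2 (fun k z => nth k (seqdec z) 0)) by eff.
    destruct Hpost as [post Hpost].
    exists (CComp post (CPair CRight (CComp c (CPair CLeft (CComp CSucc CRight))))).
    assert (Hev : forall n k y, ev O (CComp post (CPair CRight (CComp c (CPair CLeft (CComp CSucc CRight))))) ⟨n, k⟩ y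
      <-> exists z, ev O c ⟨n, S k⟩ z /\ y = nth k (seqdec z) 0).
    { intros n k y.
      assert (Hs : ev O (CPair CLeft (CComp CSucc CRight)) ⟨n, k⟩ ⟨n, S k⟩).
      { apply ev_pair; [now apply ev_left|].
        apply (ev_comp _ _ _ _ k); [now apply ev_right|reflexivity]. }
      split.
      - intros (p & (k' & z & Hk & Hz & ->) & Hy). apply ev_right in Hk as ->.
        apply (ev_comp _ _ _ _ _ _ Hs) in Hz. exists z. split; [exact Hz|].
        exact (ev_functional _ _ _ _ _ Hy (Hpost O (k, z))).
      - intros (z & Hz & ->). exists ⟨k, z⟩. split; [|apply (Hpost O (k, z))].
        apply ev_pair; [now apply ev_right|]. now apply (ev_comp _ _ _ _ _ _ Hs). }
    intros n. split.
    + intros Hn.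
      assert (Htot : forall m, exists r, ev O c ⟨n, m⟩ r).
      { induction m as [|m [r Hr]].
        - apply T0. exists 0. split; [reflexivity|exact Hn].
        - apply (T1 _ _ _ Hr). destruct (Hext' _ _ (Hc _ _ _ Hr)) as [x Hx].
          exists (seqcode (seqdec r ++ [x])). cbn [fst snd]. rewrite seqcodeK. eauto. }
      apply choice in Htot as [r Hr].
      set (Y := fun k => nth k (seqdec (r (S k))) 0).
      assert (HY : forall m, seqdec (r m) = initseg Y m).
      { induction m as [|m IH].
        - destruct (S0 _ _ (Hr 0)) as [E _]. cbn in E. now rewrite E.
        - destruct (S1 _ _ _ (Hr (S m))) as (r' & Hr' & _ & x & E). cbn [fst snd] in E.
          rewrite <- (ev_functional _ _ _ _ _ (Hr m) Hr'), IH in E.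
          rewrite initseg_S. unfold Y at 2. rewrite E, seqcodeK. f_equal. f_equal.
          rewrite app_nth2; rewrite length_initseg; [|lia]. now rewrite Nat.sub_diag. }
      exists Y. split.
      * intros m. rewrite <- HY. apply ext_T, (Hc n m), Hr.
      * intros k. apply Hev. exists (r (S k)). split; [apply Hr|reflexivity].
    + intros k y Hy. apply Hev in Hy as (z & Hz & _).
      (* Any output passes through stage 0, where the empty string was confirmed to be
         extendible. *)
      assert (H0 : forall m z, ev O c ⟨n, m⟩ z -> ext n []).
      { induction m as [|m IH]; intros z' Hz'.
        - exact (proj2 (S0 _ _ Hz')).
        - destruct (S1 _ _ _ Hz') as (r & Hr & _). exact (IH r Hr). }
      exact (H0 _ _ Hz).
Qed.

Lemma pi2_basis (P : (nat -> nat) -> nat -> Prop) : pi2 P ->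
  exists c, forall n,
    ((exists X, P X n) -> exists X, P X n /\ forall k, ev O c ⟨n, k⟩ (X k)) /\
    (forall k y, ev O c ⟨n, k⟩ y -> exists X, P X n).
Proof.
  intros HP. destruct (pi2_tree P HP) as (T & HT & HTP).
  destruct (tree_basis T HT) as [c Hc]. exists (CComp CLeft c). intros n.
  destruct (HTP n) as [H1 H2], (Hc n) as [H3 H4]. split.
  - intros [X HX]. destruct (H3 (H2 X HX)) as (Y & HY & Hev).
    eexists. split; [exact (H1 Y HY)|]. intros k. exists (Y k). split; [apply Hev|reflexivity].
  - intros k y (u & Hu & _). destruct (H4 k u Hu) as [Y HY]. eauto.
Qed.
End Basis.

(** The definition lets [D] depend on the set enumerated; members of a degree compute each other, so
    a single [D] serves all sets. *)
Lemma enumerates_oracle d : turing_degree d ->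
  enumerates_all_Sigma11 d <-> exists D, d D /\ forall A, Sigma11 A -> ce (orc D) A.
Proof.
  intros [D HD]. split.
  - intros H. exists D. split; [apply HD; split; apply turing_le_refl|].
    intros A HA. destruct (H A HA) as (D' & HD' & Hce). apply ce_in_ce.
    apply HD in HD' as [_ le]. exact (ce_in_turing_le _ _ _ le Hce).
  - intros (D' & HD' & H) A HA. exists D'. split; [exact HD'|]. apply ce_in_ce, H, HA.
Qed.

(** The shape of the Σ⁰₁ criteria in the converse directions; with [b] constantly true it expresses
    convergence somewhere. *)
Lemma ce_phi_values D (h : nat -> nat) (b : nat -> bool) : eff1 h -> eff1 b ->
  ce (orc D) (fun n => exists x y, phi D (h n) x y /\ b y = true).
Proof.
  intros Hh Hb. do 2 apply ce_ex. apply ce_and.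
  - apply (ce_comp (orc D) _ (fun _ p => ((h (fst (fst p)), snd (fst p)), snd p)) (ce_ev (orc D))).
    eff.
  - apply (ce_dec (orc D) (fun _ p => b (snd p))). eff.
Qed.

(** * Paths *)

Lemma pi2_Pi01_class : pi2 (fun X e => Pi01_class e X).
Proof.
  apply (pi2_iff (fun X e => forall m t,
    opt_elim true (fun _ => false) (bounded0 e (seqcode (initseg X m)) t) = true)).
  - intros X e. split; intros H m.
    + intros [y Hy]. apply phi0_outputs in Hy as [t Ht]. specialize (H m t).
      unfold outputs in Ht. now destruct (bounded0 _ _ _).
    + intros t. destruct (bounded0 _ _ t) as [v|] eqn:E; [|reflexivity].
      destruct (H m). exists v. apply phi0_outputs. exists t. unfold outputs. rewrite E.
      apply Nat.eqb_refl.
  - do 2 apply pi2_all.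
    apply (pi2_dec (fun X p => opt_elim true (fun _ => false)
      (bounded0 (fst (fst p)) (seqcode (initseg X (snd (fst p)))) (snd p)))). unfold initseg. eff.
Qed.

Lemma paths_of_enumeration D : (forall A, Sigma11 A -> ce (orc D) A) ->
  exists f, computable_fun f /\ finds_paths D f /\ reticent_paths D f.
Proof.
  intros HD. destruct (pi2_basis (orc D) HD _ pi2_Pi01_class) as [c Hc].
  destruct (smn c) as (f & Hf & Hev). exists f. split; [now apply eff1_computable|]. split.
  - intros e He. destruct (proj1 (Hc e) He) as (X & HX & Hk). exists X. split; [|exact HX].
    intros k. apply Hev, Hk.
  - intros e He k [y Hy]. apply He. apply Hev in Hy. exact (proj2 (Hc e) k y Hy).
Qed.

Lemma enumeration_of_paths D f A : computable_fun f -> finds_paths D f -> reticent_paths D f ->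
  Sigma11 A -> ce (orc D) A.
Proof.
  intros Hf Hp Hr HA. apply Sigma11_eff in HA as (T & HT & HA).
  (* The condition ignores the search variable, so the program halts with output 0 on strings
     outside the tree and diverges on the others. *)
  destruct (effective_search (fun _ (p : nat * nat) _ => negb (T (fst p) (seqdec (snd p)))))
    as [c Hc]; [eff|].
  destruct (smn c) as (g & Hg & Hev). apply eff1_computable in Hf.
  assert (HP : forall n X, Pi01_class (g n) X <-> forall m, T n (initseg X m) = true).
  { intros n X. unfold Pi01_class. split; intros H m.
    - apply not_false_iff_true. intros HT'. apply (H m). exists 0. apply Hev.
      apply (Hc _ (n, _)). cbn [fst snd]. rewrite seqcodeK, HT'. split; [reflexivity|lia].
    - intros [y Hy]. apply Hev, (Hc _ (n, _)) in Hy as [Hy _]. cbn [fst snd] in Hy.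
      now rewrite seqcodeK, (H m) in Hy. }
  apply (ce_iff _ (fun n => exists x y, phi D (f (g n)) x y /\ true = true)).
  2: { apply (ce_phi_values D (fun n => f (g n)) (fun _ => true)); eff. }
  intros n. rewrite HA. split.
  - intros (x & y & Hy & _). apply NNPP. intros H. apply (Hr (g n)) with (n := x); [|now exists y].
    intros [X HX]. apply H. exists X. now apply HP.
  - intros [X HX]. destruct (Hp (g n)) as (Y & HY & _); [exists X; now apply HP|].
    exists 0, (Y 0). split; [apply HY|reflexivity].
Qed.

(** * The Kleene-Brouwer order *)

(** A proper extension lies below its prefix, so the initial segments of a path descend and the
    empty string is the greatest element. *)
Fixpoint kb (s t : list nat) : bool :=
  match s, t with
  | [], _ => false
  | _ :: _, [] => true
  | x :: s, y :: t => (x <? y) || ((x =? y) && kb s t)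
  end.

Lemma kb_cons x s y t : kb (x :: s) (y :: t) = true <-> x < y \/ x = y /\ kb s t = true.
Proof.
  simpl. now rewrite orb_true_iff, andb_true_iff, Nat.ltb_lt, Nat.eqb_eq.
Qed.

Lemma kb_irrefl s : kb s s = false.
Proof.
  apply not_true_iff_false. induction s as [|x s IH]; [discriminate|].
  rewrite kb_cons. intros [H|[_ H]]; [lia|auto].
Qed.

Lemma kb_trans s t u : kb s t = true -> kb t u = true -> kb s u = true.
Proof.
  revert t u. induction s as [|x s IH]; intros [|y t] [|z u]; try discriminate; trivial.
  rewrite !kb_cons. intros [H|[-> H]] [H'|[-> H']]; try lia. right. eauto.
Qed.

Lemma kb_total s t : kb s t = true \/ s = t \/ kb t s = true.
Proof.
  revert t. induction s as [|x s IH]; intros [|y t];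
    [now right; left|now right; right|now left|].
  rewrite !kb_cons. destruct (Nat.lt_trichotomy x y) as [H|[->|H]]; auto.
  destruct (IH t) as [H|[H|H]]; auto. right; left. now f_equal.
Qed.

Lemma eff_kb : eff2 kb.
Proof.
  (* The simultaneous recursion becomes a fold over [s]; the state holds the rest of [t] and the
     verdict, if there is one. Without a verdict at the end, [s] is a prefix of [t] and the answer
     is [false]. *)
  set (step := fun (st : list nat * option bool) x =>
    opt_elim
      (list_elim (fst st, Some true)
        (fun y t => ite (x <? y) (t, Some true) (ite (x =? y) (t, None) (t, Some false)))
        (fst st))
      (fun _ => st) (snd st)).
  apply (eff_ext2 (fun s t => opt_elim false (fun b => b) (snd (fold_left step s (t, None))))).
  - assert (decided : forall s t b, fold_left step s (t, Some b) = (t, Some b)).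
    { induction s as [|x s IH]; intros t b; [reflexivity|]. apply IH. }
    intros s. induction s as [|x s IH]; intros [|y t]; try reflexivity.
    + cbn [fold_left]. change (step ([], None) x) with (@nil nat, Some true).
      now rewrite decided.
    + cbn [fold_left kb].
      change (step (y :: t, None) x) with
        (ite (x <? y) (t, Some true) (ite (x =? y) (t, None) (t, Some false))).
      destruct (x <? y); cbn [ite orb]; [now rewrite decided|].
      destruct (x =? y); cbn [ite andb]; [apply IH|now rewrite decided].
  - unfold step. eff.
Qed.
#[export] Hint Resolve eff_kb : eff.

Definition kb_descends (P : list nat -> Prop) : Prop :=
  exists h, (forall m, P (h m)) /\ forall m, kb (h (S m)) (h m) = true.

Lemma nonincreasing_stable (x : nat -> nat) : (forall m, x (S m) <= x m) ->
  exists M, forall m, x (M + m) = x M.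
Proof.
  intros Hx. assert (mono : forall M m, x (M + m) <= x M).
  { intros M. induction m as [|m IH]; [rewrite Nat.add_0_r; lia|].
    rewrite Nat.add_succ_r. specialize (Hx (M + m)). lia. }
  enough (H : forall v M, x M <= v -> exists M', forall m, x (M' + m) = x M') by exact (H (x 0) 0 (le_n _)).
  induction v as [|v IH]; intros M HM.
  - exists M. intros m. specialize (mono M m). lia.
  - destruct (classic (exists m, x (M + m) < x M)) as [[m Hm]|Hn].
    + apply (IH (M + m)). lia.
    + exists M. intros m. specialize (mono M m).
      destruct (Nat.eq_dec (x (M + m)) (x M)); [assumption|]. destruct Hn. exists m. lia.
Qed.

(** First entries never increase along the sequence, so they are eventually a constant [x], and from
    then on the tails descend. *)
Lemma kb_descends_cons (P : list nat -> Prop) :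
  kb_descends P -> exists x, kb_descends (fun r => P (x :: r)).
Proof.
  intros (h & HP & Hh).
  (* Only [h 0] can be empty, since the later terms lie below another string; hence the shift by one
     throughout. *)
  assert (E : forall m, h (S m) = hd 0 (h (S m)) :: tl (h (S m))).
  { intros m. specialize (Hh m). destruct (h (S m)); [discriminate Hh|reflexivity]. }
  assert (Hk : forall m, hd 0 (h (S (S m))) < hd 0 (h (S m)) \/
     hd 0 (h (S (S m))) = hd 0 (h (S m)) /\ kb (tl (h (S (S m)))) (tl (h (S m))) = true).
  { intros m. apply kb_cons. rewrite <- !E. apply Hh. }
  destruct (nonincreasing_stable (fun m => hd 0 (h (S m)))) as [M HM].
  { intros m. destruct (Hk m); lia. }
  exists (hd 0 (h (S M))), (fun m => tl (h (S (M + m)))). split; intros m.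
  - rewrite <- (HM m), <- E. apply HP.
  - rewrite Nat.add_succ_r. destruct (Hk (M + m)) as [H|[_ H]]; [|exact H].
    pose proof (HM m). pose proof (HM (S m)) as H1. cbn in H1. rewrite Nat.add_succ_r in H1. lia.
Qed.

(** Repeated use of [kb_descends_cons] prolongs a string above which the descent continues; closure
    under prefixes then puts the string itself into [P]. *)
Lemma kb_descends_path (P : list nat -> Prop) : (forall s t, P (s ++ t) -> P s) ->
  kb_descends P -> exists X, forall m, P (initseg X m).
Proof.
  intros closed HP.
  assert (Hf : forall s, exists x, kb_descends (fun r => P (s ++ r)) ->
    kb_descends (fun r => P ((s ++ [x]) ++ r))).
  { intros s. destruct (classic (kb_descends (fun r => P (s ++ r)))) as [H|H].
    - apply kb_descends_cons in H as [x (h & H1 & H2)]. exists x. intros _. exists h.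
      split; [|exact H2]. intros m. rewrite <- app_assoc. apply H1.
    - exists 0. contradiction. }
  apply choice in Hf as [f Hf].
  set (s := nrec [] (fun _ r => r ++ [f r])).
  exists (fun k => f (s k)). intros m.
  assert (E : initseg (fun k => f (s k)) m = s m).
  { induction m as [|m IH]; [reflexivity|]. rewrite initseg_S, IH. reflexivity. }
  rewrite E. assert (H : kb_descends (fun r => P (s m ++ r))).
  { clear E. induction m as [|m IH]; [exact HP|]. apply Hf, IH. }
  destruct H as (h & H & _). exact (closed _ _ (H 0)).
Qed.

(** [T n] can contain a string without its prefixes. Keeping the strings all of whose prefixes are
    accepted gives a tree with the same paths. *)
Definition tree_closure (T : nat -> list nat -> bool) (n : nat) (s : list nat) : bool :=
  forallb (fun m => T n (initseg (fun i => nth i s 0) m)) (seq 0 (S (length s))).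

Lemma tree_closure_true T n s : tree_closure T n s = true <->
  forall m, m <= length s -> T n (initseg (fun i => nth i s 0) m) = true.
Proof.
  unfold tree_closure. rewrite forallb_forall. split.
  - intros H m Hm. apply H, in_seq. lia.
  - intros H m Hm. apply in_seq in Hm. apply H. lia.
Qed.

Lemma initseg_ext X Y m : (forall k, k < m -> X k = Y k) -> initseg X m = initseg Y m.
Proof. intros H. apply map_ext_in. intros k Hk. apply in_seq in Hk. apply H. lia. Qed.

Lemma tree_closure_prefix T n s t :
  tree_closure T n (s ++ t) = true -> tree_closure T n s = true.
Proof.
  rewrite !tree_closure_true, length_app. intros H m Hm. rewrite <- (H m) by lia.
  f_equal. apply initseg_ext. intros k Hk. now rewrite app_nth1 by lia.
Qed.

Lemma tree_closure_path T n X :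
  (forall m, tree_closure T n (initseg X m) = true) <-> forall m, T n (initseg X m) = true.
Proof.
  assert (E : forall m k, k <= m -> initseg (fun i => nth i (initseg X m) 0) k = initseg X k).
  { intros m k Hk. apply initseg_ext. intros i Hi. apply nth_initseg. lia. }
  split; intros H m.
  - specialize (H m). rewrite tree_closure_true, length_initseg in H.
    rewrite <- (E m m) by lia. now apply H.
  - apply tree_closure_true. rewrite length_initseg. intros k Hk. now rewrite E.
Qed.

Lemma eff_tree_closure T : eff2 T -> eff2 (tree_closure T).
Proof. intros HT. unfold tree_closure, initseg. eff. Qed.
#[export] Hint Resolve eff_tree_closure : eff.

(** The Kleene-Brouwer order of the [n]-th tree, on the numbers [⟨0, s⟩];
    if [b] then a copy of ω* is put on top of it, on the numbers [⟨1, k⟩]. *)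
Section KBOrder.
Variables (T : nat -> list nat -> bool) (b : bool) (n : nat).

Definition kb_dom (z : nat) : bool :=
  let p := Cantor.of_nat z in
  ite (fst p =? 0) (tree_closure T n (seqdec (snd p))) (b && (fst p =? 1)).

Definition kb_lt (z w : nat) : bool :=
  let p := Cantor.of_nat z in
  let q := Cantor.of_nat w in
  ite (fst p =? 0)
    (ite (fst q =? 0) (kb (seqdec (snd p)) (seqdec (snd q))) true)
    (ite (fst q =? 0) false (snd q <? snd p)).

Lemma kb_dom_cases z : kb_dom z = true ->
  exists i, z = ⟨0, i⟩ /\ tree_closure T n (seqdec i) = true \/ z = ⟨1, i⟩ /\ b = true.
Proof.
  unfold kb_dom. pose proof (Cantor.cancel_to_of z) as E.
  destruct (Cantor.of_nat z) as [a i]. cbn [fst snd]. intros H. exists i. subst z.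
  destruct (Nat.eqb_spec a 0) as [->|_]; cbn [ite] in H; [now left|].
  right. apply andb_prop in H as [H1 H2]. now apply Nat.eqb_eq in H2 as ->.
Qed.

Lemma kb_lt00 i j : kb_lt ⟨0, i⟩ ⟨0, j⟩ = kb (seqdec i) (seqdec j).
Proof. unfold kb_lt. now rewrite !Cantor.cancel_of_to. Qed.
Lemma kb_lt01 i j : kb_lt ⟨0, i⟩ ⟨1, j⟩ = true.
Proof. unfold kb_lt. now rewrite !Cantor.cancel_of_to. Qed.
Lemma kb_lt10 i j : kb_lt ⟨1, i⟩ ⟨0, j⟩ = false.
Proof. unfold kb_lt. now rewrite !Cantor.cancel_of_to. Qed.
Lemma kb_lt11 i j : kb_lt ⟨1, i⟩ ⟨1, j⟩ = (j <? i).
Proof. unfold kb_lt. now rewrite !Cantor.cancel_of_to. Qed.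

Lemma kb_lt_irrefl x : kb_dom x = true -> kb_lt x x = false.
Proof.
  intros H. destruct (kb_dom_cases x H) as [i [[-> _]|[-> _]]].
  - rewrite kb_lt00. apply kb_irrefl.
  - rewrite kb_lt11. apply Nat.ltb_irrefl.
Qed.

Lemma kb_lt_trans x y z : kb_dom x = true -> kb_dom y = true -> kb_dom z = true ->
  kb_lt x y = true -> kb_lt y z = true -> kb_lt x z = true.
Proof.
  intros Hx Hy Hz. destruct (kb_dom_cases x Hx) as [i [[-> _]|[-> _]]],
    (kb_dom_cases y Hy) as [j [[-> _]|[-> _]]], (kb_dom_cases z Hz) as [k [[-> _]|[-> _]]];
    rewrite ?kb_lt00, ?kb_lt01, ?kb_lt10, ?kb_lt11, ?Nat.ltb_lt; try easy; try lia.
  apply kb_trans.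
Qed.

Lemma kb_lt_total x y : kb_dom x = true -> kb_dom y = true ->
  kb_lt x y = true \/ x = y \/ kb_lt y x = true.
Proof.
  intros Hx Hy. destruct (kb_dom_cases x Hx) as [i [[-> _]|[-> _]]],
    (kb_dom_cases y Hy) as [j [[-> _]|[-> _]]];
    rewrite ?kb_lt00, ?kb_lt01, ?kb_lt10, ?kb_lt11, ?Nat.ltb_lt; auto.
  - destruct (kb_total (seqdec i) (seqdec j)) as [H|[H|H]]; auto.
    right; left. now rewrite <- (seqdecK i), <- (seqdecK j), H.
  - destruct (Nat.lt_trichotomy i j) as [H|[->|H]]; auto.
Qed.

Definition kb_order : linear_order :=
  LinearOrder kb_dom kb_lt kb_lt_irrefl kb_lt_trans kb_lt_total.

Lemma kb_order_descending X : (forall m, T n (initseg X m) = true) ->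
  descending kb_order (fun m => ⟨0, seqcode (initseg X m)⟩).
Proof.
  intros HX. split; intros m; cbn [ldom llt kb_order].
  - unfold kb_dom. rewrite Cantor.cancel_of_to. cbn [fst snd Nat.eqb ite].
    rewrite seqcodeK. now apply tree_closure_path.
  - rewrite kb_lt00, !seqcodeK, initseg_S. generalize (initseg X m) as s.
    induction s as [|x s IH]; [reflexivity|]. apply kb_cons. auto.
Qed.

(** The copy of ω* lies on top, so a descending sequence that has entered the tree never leaves
    it. *)
Lemma kb_order_path g m : descending kb_order g -> fst (Cantor.of_nat (g m)) = 0 ->
  exists X, forall k, T n (initseg X k) = true.
Proof.
  intros [Hd Hl] Hm. cbn [ldom llt kb_order] in Hd, Hl.
  assert (H0 : forall k, exists i, g (m + k) = ⟨0, i⟩ /\ tree_closure T n (seqdec i) = true).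
  { induction k as [|k [i [Hi _]]].
    - rewrite Nat.add_0_r. destruct (kb_dom_cases _ (Hd m)) as [i [[E H]|[E H]]]; [eauto|].
      now rewrite E, Cantor.cancel_of_to in Hm.
    - rewrite Nat.add_succ_r.
      destruct (kb_dom_cases _ (Hd (S (m + k)))) as [j [[E H]|[E H]]]; [eauto|].
      specialize (Hl (m + k)). now rewrite Hi, E, kb_lt10 in Hl. }
  apply choice in H0 as [i Hi].
  destruct (kb_descends_path (fun s => tree_closure T n s = true)) as [X HX].
  - apply tree_closure_prefix.
  - exists (fun k => seqdec (i k)). split; intros k; [apply Hi|].
    rewrite <- kb_lt00, <- !(proj1 (Hi _)), Nat.add_succ_r. apply Hl.
  - exists X. now apply tree_closure_path.
Qed.
End KBOrder.

Lemma kb_order_index T b : eff2 T ->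
  exists g, eff1 g /\ forall n, names_order (g n) (kb_order T b n).
Proof.
  intros HT.
  destruct (index_total (fun n z => Nat.b2n (ite (fst (Cantor.of_nat z) =? 0)
     (kb_dom T b n (snd (Cantor.of_nat z)))
     (kb_lt (fst (Cantor.of_nat (snd (Cantor.of_nat z))))
            (snd (Cantor.of_nat (snd (Cantor.of_nat z)))))))) as (g & Hg & H).
  { unfold kb_dom, kb_lt. eff. }
  exists g. split; [exact Hg|]. intros n. split.
  - intros x. specialize (H n ⟨0, x⟩). now rewrite !Cantor.cancel_of_to in H.
  - intros x y _ _. specialize (H n ⟨1, ⟨x, y⟩⟩). rewrite !Cantor.cancel_of_to in H.
    cbn [fst snd Nat.eqb ite] in H. now rewrite !Cantor.cancel_of_to in H.
Qed.

(** Two orders with the same name may compare numbers outside the domain differently, but they agree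
    on the terms of a descending sequence. *)
Lemma names_order_descending e L L' g : names_order e L -> names_order e L' ->
  descending L g -> descending L' g.
Proof.
  intros [L1 L2] [N1 N2] [H1 H2].
  assert (dom : forall x, ldom L' x = ldom L x).
  { intros z. apply enc_bool_inj. exact (ev_functional _ _ _ _ _ (N1 z) (L1 z)). }
  split; intros k; [rewrite dom; apply H1|]. rewrite <- (H2 k). apply enc_bool_inj.
  refine (ev_functional _ _ _ _ _ (N2 _ _ _ _) (L2 _ _ _ _)); rewrite ?dom; apply H1.
Qed.

Lemma enumeration_of_descending D f A : computable_fun f -> finds_descending D f ->
  reticent_descending D f -> Sigma11 A -> ce (orc D) A.
Proof.
  intros Hf Hd Hr HA. apply Sigma11_eff in HA as (T & HT & HA).
  destruct (kb_order_index T false HT) as (g & Hg & Hn). apply eff1_computable in Hf.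
  apply (ce_iff _ (fun n => exists x y, phi D (f (g n)) x y /\ true = true)).
  2: { apply (ce_phi_values D (fun n => f (g n)) (fun _ => true)); eff. }
  intros n. rewrite HA. split.
  - intros (x & y & Hy & _). apply NNPP. intros H. apply (Hr (g n)) with (n := x); [|now exists y].
    intros (L & HL & h & Hh). apply H.
    apply (names_order_descending _ _ _ _ HL (Hn n)) in Hh.
    apply (kb_order_path T false n h 0 Hh).
    destruct (kb_dom_cases _ _ _ _ (proj1 Hh 0)) as [i [[E _]|[_ E]]]; [|discriminate E].
    now rewrite E, Cantor.cancel_of_to.
  - intros [X HX]. destruct (Hd (g n) _ (Hn n)) as (h & Hh & _).
    + eexists. apply kb_order_descending, HX.
    + exists 0, (h 0). split; [apply Hh|reflexivity].
Qed.

Lemma enumeration_of_tight D f A : computable_fun f -> finds_tight_descending D f ->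
  Sigma11 A -> ce (orc D) A.
Proof.
  intros Hf Hd HA. apply Sigma11_eff in HA as (T & HT & HA).
  destruct (kb_order_index T true HT) as (g & Hg & Hn). apply eff1_computable in Hf.
  apply (ce_iff _ (fun n => exists x y, phi D (f (g n)) x y /\ (fst (Cantor.of_nat y) =? 0) = true)).
  2: { apply (ce_phi_values D (fun n => f (g n)) (fun y => fst (Cantor.of_nat y) =? 0)); eff. }
  intros n. rewrite HA.
  destruct (Hd (g n) _ (Hn n)) as (h & Hh & Hdesc & Htight).
  (* The copy of ω* makes the order ill-founded for every [n], so [h] exists whether or not there is
     a path. *)
  { exists (fun k => ⟨1, k⟩). split; intros k; cbn [ldom llt kb_order].
    - unfold kb_dom. now rewrite Cantor.cancel_of_to.
    - rewrite kb_lt11. apply Nat.ltb_lt. lia. }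
  split.
  - intros (x & y & Hy & E). apply (kb_order_path T true n h x Hdesc).
    rewrite (ev_functional _ _ _ _ _ (Hh x) Hy). now apply Nat.eqb_eq.
  (* A term of [h] below one node of the path cannot belong to ω*. *)
  - intros [X HX]. destruct (Htight _ (kb_order_descending T true n X HX) 0) as [m Hm].
    exists m, (h m). split; [apply Hh|]. cbn [llt kb_order] in Hm.
    destruct (kb_dom_cases _ _ _ _ (proj1 Hdesc m)) as [i [[E _]|[E _]]]; rewrite E in Hm |- *.
    + now rewrite Cantor.cancel_of_to.
    + now rewrite kb_lt10 in Hm.
Qed.

(** * Tight descending sequences *)

Ltac pi2 :=
  repeat (cbv beta; first [apply pi2_and | apply pi2_all | apply pi2_imp | apply pi2_phi0
    | apply pi2_dec | apply pi2_ex]); eff.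

(** That [e] names an order is part of the predicate, so finding any such [x] already certifies that
    [e] is in the relevant set. *)
Definition below_descending (e x : nat) : Prop :=
  exists L g, names_order e L /\ descending L g /\ g 0 = x.

Section OrderCode.
Variable X : nat -> nat.
Let dom (x : nat) : bool := X ⟨0, ⟨0, x⟩⟩ =? 1.
Let lt (x y : nat) : bool := X ⟨0, ⟨1, ⟨x, y⟩⟩⟩ =? 1.

(** [X ⟨0, z⟩] is the value of the [e]-th program at [z], and [X ⟨1, k⟩] is the
    [k]-th term of a descending sequence. *)
Definition codes_descending (e x0 : nat) : Prop :=
  (forall x, X ⟨0, ⟨0, x⟩⟩ <=? 1 = true /\ phi0 e ⟨0, x⟩ (X ⟨0, ⟨0, x⟩⟩)) /\
  (forall x y, dom x && dom y = true ->
     X ⟨0, ⟨1, ⟨x, y⟩⟩⟩ <=? 1 = true /\ phi0 e ⟨1, ⟨x, y⟩⟩ (X ⟨0, ⟨1, ⟨x, y⟩⟩⟩)) /\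
  (forall x, dom x = true -> negb (lt x x) = true) /\
  (forall x y z, dom x && dom y && dom z = true -> lt x y && lt y z = true -> lt x z = true) /\
  (forall x y, dom x && dom y = true -> lt x y || (x =? y) || lt y x = true) /\
  (X ⟨1, 0⟩ =? x0) = true /\
  (forall k, dom (X ⟨1, k⟩) = true) /\
  (forall k, lt (X ⟨1, S k⟩) (X ⟨1, k⟩) = true).

Lemma b2n_eqb1 n : n <=? 1 = true -> Nat.b2n (n =? 1) = n.
Proof. destruct n as [|[|n]]; trivial. discriminate. Qed.

Lemma codes_descending_sound e x0 : codes_descending e x0 -> below_descending e x0.
Proof.
  intros (H1 & H2 & H3 & H4 & H5 & H6 & H7 & H8).
  unshelve eexists (LinearOrder dom lt _ _ _), (fun k => X ⟨1, k⟩).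
  - intros x Hx. now apply negb_true_iff, H3.
  - intros x y z Hx Hy Hz Hxy Hyz. apply (H4 x y z); now rewrite ?Hx, ?Hy, ?Hz, ?Hxy, ?Hyz.
  - intros x y Hx Hy. specialize (H5 x y). rewrite Hx, Hy, !orb_true_iff, Nat.eqb_eq in H5.
    destruct (H5 eq_refl) as [[?|?]|?]; auto.
  - split; [split|split; [split|]]; cbn [ldom llt].
    + intros x. destruct (H1 x) as [Hx Hp]. unfold dom. now rewrite b2n_eqb1.
    + intros x y Hx Hy. destruct (H2 x y) as [Hl Hp]; [now rewrite Hx, Hy|].
      unfold lt. now rewrite b2n_eqb1.
    + exact H7.
    + exact H8.
    + now apply Nat.eqb_eq.
Qed.
End OrderCode.

Lemma codes_descending_complete e x0 :
  below_descending e x0 -> exists X, codes_descending X e x0.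
Proof.
  intros (L & g & [N1 N2] & [G1 G2] & G0).
  set (X := fun z => let p := Cantor.of_nat z in
    let q := Cantor.of_nat (snd p) in
    let r := Cantor.of_nat (snd q) in
    if fst p =? 0 then
      if fst q =? 0 then Nat.b2n (ldom L (snd q))
      else Nat.b2n (llt L (fst r) (snd r))
    else g (snd p)).
  exists X. unfold codes_descending.
  assert (Xd : forall x, X ⟨0, ⟨0, x⟩⟩ = Nat.b2n (ldom L x)).
  { intros x. unfold X. rewrite !Cantor.cancel_of_to. cbn [fst snd].
    now rewrite !Cantor.cancel_of_to. }
  assert (Xl : forall x y, X ⟨0, ⟨1, ⟨x, y⟩⟩⟩ = Nat.b2n (llt L x y)).
  { intros x y. unfold X. rewrite !Cantor.cancel_of_to. cbn [fst snd].
    rewrite !Cantor.cancel_of_to. cbn [fst snd]. now rewrite !Cantor.cancel_of_to. }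
  assert (Xg : forall k, X ⟨1, k⟩ = g k).
  { intros k. unfold X. now rewrite !Cantor.cancel_of_to. }
  assert (B : forall b, (Nat.b2n b =? 1) = b) by now intros [].
  assert (B' : forall b, (Nat.b2n b <=? 1) = true) by now intros [].
  repeat split; intros; rewrite ?Xd, ?Xl, ?Xg, ?B, ?B' in *; trivial.
  - apply andb_prop in H as [Hx Hy]. auto.
  - apply negb_true_iff, llt_irrefl, H.
  - apply andb_prop in H as [H Hz]. apply andb_prop in H as [Hx Hy].
    apply andb_prop in H0 as [? ?]. eauto using llt_trans.
  - apply andb_prop in H as [Hx Hy]. rewrite !orb_true_iff, Nat.eqb_eq.
    destruct (llt_total L x y Hx Hy) as [?|[?|?]]; auto.
  - now apply Nat.eqb_eq.
Qed.

Lemma Sigma11_below_descending :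
  Sigma11 (fun n => below_descending (fst (Cantor.of_nat n)) (snd (Cantor.of_nat n))).
Proof.
  destruct (Sigma11_pi2 (fun X n =>
    codes_descending X (fst (Cantor.of_nat n)) (snd (Cantor.of_nat n)))) as (R & HR & E).
  { unfold codes_descending. pi2. }
  exists R. split; [exact HR|]. intros n. rewrite <- E.
  split; [apply codes_descending_complete|intros [X HX]; exact (codes_descending_sound X _ _ HX)].
Qed.

(* Term m + 1 is chosen below term m and, if m = ⟨w, t⟩ and w has been seen at
   stage t to start a descending sequence, also below w. *)
Lemma tight_of_enumeration D : (forall A, Sigma11 A -> ce (orc D) A) ->
  exists f, computable_fun f /\ finds_tight_descending D f /\ reticent_descending D f.
Proof.
  intros HD. set (O := orc D).
  assert (Hce := HD _ Sigma11_below_descending). fold O in Hce.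
  destruct Hce as (F & HF & HS).
  assert (HS' : forall e x, below_descending e x <-> exists t, F O (⟨e, x⟩, t) = true).
  { intros e x. rewrite <- HS, Cantor.cancel_of_to. reflexivity. }
  assert (ce_below : ce O (fun p : nat * nat => below_descending (fst p) (snd p))).
  { exists (fun O p => F O (⟨fst (fst p), snd (fst p)⟩, snd p)). split; [eff|].
    intros p. apply HS'. }
  destruct (ce_dependent_choice O (fun p => below_descending (fst p) (snd p))
    (fun p => below_descending (fst (fst p)) (snd p) /\
      phi0 (fst (fst p)) ⟨1, ⟨snd p, snd (snd (fst p))⟩⟩ 1 /\
      (F O (⟨fst (fst p), fst (Cantor.of_nat (fst (snd (fst p))))⟩,
            snd (Cantor.of_nat (fst (snd (fst p))))) = true ->
       phi0 (fst (fst p)) ⟨1, ⟨snd p, fst (Cantor.of_nat (fst (snd (fst p))))⟩⟩ 1)))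
    as (c & S0 & S1 & T0 & T1).
  { exact ce_below. }
  { apply ce_and; [|apply ce_and].
    - apply (ce_comp O _ (fun _ p => (fst (fst p), snd p)) ce_below). eff.
    - apply (ce_comp O _ (fun _ p => ((fst (fst p), ⟨1, ⟨snd p, snd (snd (fst p))⟩⟩), 1)) (ce_phi0 O)). eff.
    - apply (ce_imp O (fun O p => F O (⟨fst (fst p), fst (Cantor.of_nat (fst (snd (fst p))))⟩,
            snd (Cantor.of_nat (fst (snd (fst p))))))); [eff|].
      apply (ce_comp O _ (fun _ p => ((fst (fst p),
        ⟨1, ⟨snd p, fst (Cantor.of_nat (fst (snd (fst p))))⟩⟩), 1)) (ce_phi0 O)). eff. }
  cbn [fst snd] in *.
  assert (Sb : forall e m r, ev O c ⟨e, m⟩ r -> below_descending e r).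
  { intros e [|m] r Hr; [exact (S0 _ _ Hr)|]. now destruct (S1 _ _ _ Hr) as (r' & _ & H & _). }
  destruct (smn c) as (f & Hf & Hev). exists f.
  split; [now apply eff1_computable|]. split.
  - intros e L HL [h0 Hh0].
    assert (dom : forall x, below_descending e x ->
      exists g, descending L g /\ g 0 = x).
    { intros x (L' & g & HL' & Hg & E). exists g. split; [|exact E].
      exact (names_order_descending _ _ _ _ HL' HL Hg). }
    assert (ldom_below : forall x, below_descending e x -> ldom L x = true).
    { intros x Hx. destruct (dom x Hx) as (g & Hg & <-). apply Hg. }
    (* Outside the domain the output of [e] on a pair means nothing; elements that start descending
       sequences are in the domain. *)
    assert (lt_iff : forall x y, below_descending e x -> below_descending e y ->
      phi0 e ⟨1, ⟨x, y⟩⟩ 1 <-> llt L x y = true).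
    { intros x y Hx Hy. pose proof (proj2 HL x y (ldom_below x Hx) (ldom_below y Hy)) as H.
      split.
      - intros H'. apply enc_bool_inj. exact (ev_functional _ _ _ _ _ H H').
      - intros E. rewrite E in H. exact H. }
    assert (tail : forall g k, descending L g -> below_descending e (g k)).
    { intros g k [G1 G2]. exists L, (fun i => g (i + k)). split; [exact HL|].
      split; [|reflexivity]. split; intros i; [apply G1|apply (G2 (i + k))]. }
    (* The second term of a descending sequence from the smaller of the two is below both and again
       starts such a sequence. *)
    assert (lower : forall x y, below_descending e x -> below_descending e y ->
      exists z, below_descending e z /\ llt L z x = true /\ llt L z y = true).
    { assert (lower1 : forall x, below_descending e x ->
        exists z, below_descending e z /\ llt L z x = true).
      { intros x Hx. destruct (dom x Hx) as (g & Hg & <-). exists (g 1).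
        split; [now apply tail|]. apply Hg. }
      intros x y Hx Hy.
      destruct (llt_total L x y (ldom_below x Hx) (ldom_below y Hy)) as [H|[->|H]].
      - destruct (lower1 x Hx) as (z & Hz & Hl). exists z.
        split; [exact Hz|]. split; [exact Hl|]. apply (llt_trans L z x y); auto.
      - destruct (lower1 y Hy) as (z & Hz & Hl). eauto.
      - destruct (lower1 y Hy) as (z & Hz & Hl). exists z.
        split; [exact Hz|]. split; [|exact Hl]. apply (llt_trans L z y x); auto. }
    assert (Htot : forall m, exists r, ev O c ⟨e, m⟩ r).
    { induction m as [|m [r Hr]].
      - apply T0. exists (h0 0). now apply tail.
      - apply (T1 _ _ _ Hr). assert (Hb := Sb _ _ _ Hr).
        destruct (F O (⟨e, fst (Cantor.of_nat m)⟩, snd (Cantor.of_nat m))) eqn:EF.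
        + assert (Hw : below_descending e (fst (Cantor.of_nat m))) by (apply HS'; eauto).
          destruct (lower r _ Hb Hw) as (z & Hz & Hl & Hl'). exists z.
          split; [exact Hz|]. split; [now apply lt_iff|]. intros _. now apply lt_iff.
        + destruct (lower r r Hb Hb) as (z & Hz & Hl & _). exists z.
          split; [exact Hz|]. split; [now apply lt_iff|discriminate]. }
    apply choice in Htot as [g Hg].
    assert (Hstep : forall m, llt L (g (S m)) (g m) = true /\
      (F O (⟨e, fst (Cantor.of_nat m)⟩, snd (Cantor.of_nat m)) = true ->
       llt L (g (S m)) (fst (Cantor.of_nat m)) = true)).
    { intros m. destruct (S1 _ _ _ (Hg (S m))) as (r & Hr & Hb & Hl & Hw).
      rewrite <- (ev_functional _ _ _ _ _ (Hg m) Hr) in Hl.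
      assert (Hbm := Sb _ _ _ (Hg m)). split; [now apply lt_iff|].
      intros EF. apply lt_iff; [exact Hb|apply HS'; eauto|now apply Hw]. }
    exists g. split; [intros k; apply Hev, Hg|]. split; [split|].
    + intros k. exact (ldom_below _ (Sb _ _ _ (Hg k))).
    + intros k. apply Hstep.
    (* The tail of [h] from [k] descends, so [h k] is enumerated at some stage [t], and the step
       with number [⟨h k, t⟩] goes below it. *)
    + intros h Hh k. destruct (proj1 (HS' e (h k)) (tail h k Hh)) as [t Ht].
      exists (S ⟨h k, t⟩). destruct (Hstep ⟨h k, t⟩) as [_ H].
      rewrite Cantor.cancel_of_to in H. now apply H.
  - intros e He k [y Hy]. apply He. apply Hev in Hy.
    destruct (Sb _ _ _ Hy) as (L & g & HL & Hg & _). exists L. split; [exact HL|]. now exists g.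
Qed.

(** * Isomorphisms *)

Definition symdec (n : nat) : symbol :=
  if n =? 0 then NoSym
  else if Nat.odd n then RelSym (Nat.div2 n) else FunSym (Nat.div2 n - 1).

(** Every number is the code of a symbol, so any function can be read as a language. *)
Lemma symdecK n : symcode (symdec n) = n.
Proof.
  unfold symdec. destruct (Nat.eqb_spec n 0) as [->|Hn]; [reflexivity|].
  pose proof (Nat.div2_odd n). destruct (Nat.odd n); cbn [symcode Nat.b2n] in *; lia.
Qed.

Lemma symcode_inj s t : symcode s = symcode t -> s = t.
Proof. destruct s, t; cbn [symcode]; intros; trivial; try lia; f_equal; lia. Qed.

(** The function [G] is meant to be the restriction of a program naming a
    structure to the inputs on which its values matter. *)
Definition sdom (G : nat -> nat) (x : nat) : bool := G ⟨1, x⟩ =? 1.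

Definition rel_tuple (G : nat -> nat) (k a : nat) : bool :=
  (G ⟨0, k⟩ =? 1 + 2 * length (seqdec a)) && forallb (fun x => sdom G x) (seqdec a).

Definition fun_tuple (G : nat -> nat) (k a : nat) : bool :=
  (G ⟨0, k⟩ =? 2 + 2 * length (seqdec a)) && forallb (fun x => sdom G x) (seqdec a).

Definition names_via (i : nat) (G : nat -> nat) : Prop :=
  (forall k, phi0 i ⟨0, k⟩ (G ⟨0, k⟩)) /\
  (forall x, (G ⟨1, x⟩ <=? 1) = true /\ phi0 i ⟨1, x⟩ (G ⟨1, x⟩)) /\
  (exists x, sdom G x = true) /\
  (forall k a, rel_tuple G k a = true ->
     (G ⟨2, ⟨k, a⟩⟩ <=? 1) = true /\ phi0 i ⟨2, ⟨k, a⟩⟩ (G ⟨2, ⟨k, a⟩⟩)) /\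
  (forall k a, fun_tuple G k a = true ->
     sdom G (G ⟨2, ⟨k, a⟩⟩) = true /\ phi0 i ⟨2, ⟨k, a⟩⟩ (G ⟨2, ⟨k, a⟩⟩)).

(** With the inverse among the data, bijectivity becomes a family of guarded equations. *)
Definition iso_via (G H f f' : nat -> nat) : Prop :=
  (forall k, (G ⟨0, k⟩ =? H ⟨0, k⟩) = true) /\
  (forall x, sdom G x = true -> sdom H (f x) && (f' (f x) =? x) = true) /\
  (forall y, sdom H y = true -> sdom G (f' y) && (f (f' y) =? y) = true) /\
  (forall k a, rel_tuple G k a = true ->
     (G ⟨2, ⟨k, a⟩⟩ =? H ⟨2, ⟨k, seqcode (map (fun x => f x) (seqdec a))⟩⟩) = true) /\
  (forall k a, fun_tuple G k a = true ->
     (f (G ⟨2, ⟨k, a⟩⟩) =? H ⟨2, ⟨k, seqcode (map (fun x => f x) (seqdec a))⟩⟩) = true).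

Definition agrees (M : structure) (G : nat -> nat) : Prop :=
  (forall k, symcode (lang M k) = G ⟨0, k⟩) /\
  (forall x, Nat.b2n (dom M x) = G ⟨1, x⟩) /\
  (forall k n a, lang M k = RelSym n -> tuple_in (dom M) n a ->
     Nat.b2n (rel M k a) = G ⟨2, ⟨k, seqcode a⟩⟩) /\
  (forall k n a, lang M k = FunSym n -> tuple_in (dom M) n a ->
     fn M k a = G ⟨2, ⟨k, seqcode a⟩⟩).

Lemma forallb_Forall {A} (p : A -> bool) l : forallb p l = true <-> Forall (fun x => p x = true) l.
Proof. now rewrite forallb_forall, Forall_forall. Qed.

Lemma agrees_dom M G x : agrees M G -> dom M x = sdom G x.
Proof.
  intros (_ & H & _). unfold sdom. rewrite <- H. now destruct (dom M x).
Qed.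

Lemma agrees_rel_tuple M G k a : agrees M G -> rel_tuple G k a = true <->
  exists n, lang M k = RelSym n /\ tuple_in (dom M) n (seqdec a).
Proof.
  intros HM. unfold rel_tuple. rewrite andb_true_iff, Nat.eqb_eq, forallb_Forall.
  rewrite <- (proj1 HM k). change (1 + 2 * ?n) with (symcode (RelSym n)). unfold tuple_in.
  split.
  - intros [E F]. apply symcode_inj in E. eexists. split; [exact E|]. split; [reflexivity|].
    revert F. apply Forall_impl. intros x. now rewrite (agrees_dom M G).
  - intros (n & -> & <- & F). split; [reflexivity|]. revert F. apply Forall_impl.
    intros x. now rewrite (agrees_dom M G).
Qed.

Lemma agrees_fun_tuple M G k a : agrees M G -> fun_tuple G k a = true <->
  exists n, lang M k = FunSym n /\ tuple_in (dom M) n (seqdec a).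
Proof.
  intros HM. unfold fun_tuple. rewrite andb_true_iff, Nat.eqb_eq, forallb_Forall.
  rewrite <- (proj1 HM k). change (2 + 2 * ?n) with (symcode (FunSym n)). unfold tuple_in.
  split.
  - intros [E F]. apply symcode_inj in E. eexists. split; [exact E|]. split; [reflexivity|].
    revert F. apply Forall_impl. intros x. now rewrite (agrees_dom M G).
  - intros (n & -> & <- & F). split; [reflexivity|]. revert F. apply Forall_impl.
    intros x. now rewrite (agrees_dom M G).
Qed.

Lemma names_via_structure i G : names_via i G -> exists M, names_structure i M /\ agrees M G.
Proof.
  intros (H0 & H1 & Hne & Hr & Hf).
  assert (Htup : forall n a, tuple_in (fun x => sdom G x) n a <->
    length (seqdec (seqcode a)) = n /\ forallb (fun x => sdom G x) (seqdec (seqcode a)) = true).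
  { intros n a. rewrite seqcodeK, forallb_Forall. reflexivity. }
  assert (Hrel : forall k n a, symdec (G ⟨0, k⟩) = RelSym n -> tuple_in (fun x => sdom G x) n a ->
    rel_tuple G k (seqcode a) = true).
  { intros k n a E. rewrite Htup. intros [<- F]. unfold rel_tuple. rewrite F, andb_true_r.
    apply Nat.eqb_eq. rewrite <- (symdecK (G ⟨0, k⟩)), E. reflexivity. }
  assert (Hfun : forall k n a, symdec (G ⟨0, k⟩) = FunSym n -> tuple_in (fun x => sdom G x) n a ->
    fun_tuple G k (seqcode a) = true).
  { intros k n a E. rewrite Htup. intros [<- F]. unfold fun_tuple. rewrite F, andb_true_r.
    apply Nat.eqb_eq. rewrite <- (symdecK (G ⟨0, k⟩)), E. reflexivity. }
  unshelve eexists (Structure (fun k => symdec (G ⟨0, k⟩)) (fun x => sdom G x)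
    (fun k a => G ⟨2, ⟨k, seqcode a⟩⟩ =? 1) (fun k a => G ⟨2, ⟨k, seqcode a⟩⟩) Hne _).
  { intros k n a E Ha. apply Hf, (Hfun k n a E Ha). }
  assert (Hag : agrees (Structure (fun k => symdec (G ⟨0, k⟩)) (fun x => sdom G x)
    (fun k a => G ⟨2, ⟨k, seqcode a⟩⟩ =? 1) (fun k a => G ⟨2, ⟨k, seqcode a⟩⟩) Hne
    (fun k n a E Ha => proj1 (Hf k (seqcode a) (Hfun k n a E Ha)))) G).
  { split; [|split; [|split]]; cbn [lang dom rel fn].
    - intros k. apply symdecK.
    - intros x. apply b2n_eqb1, H1.
    - intros k n a E Ha. apply b2n_eqb1, Hr, (Hrel k n a E Ha).
    - reflexivity. }
  split; [|exact Hag]. destruct Hag as (A0 & A1 & A2 & A3).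
  split; [|split; [|split]]; cbn [lang dom rel fn] in *.
  - intros k. rewrite A0. apply H0.
  - intros x. rewrite A1. apply H1.
  - intros k n a E Ha. rewrite (A2 k n a E Ha). apply Hr, (Hrel k n a E Ha).
  - intros k n a E Ha. apply Hf, (Hfun k n a E Ha).
Qed.

(** Both sides are outputs of the same program [i], and programs are single-valued. *)
Lemma names_via_agrees i M G : names_structure i M -> names_via i G -> agrees M G.
Proof.
  intros (N0 & N1 & N2 & N3) (H0 & H1 & _ & Hr & Hf).
  assert (fnl : forall x y z, phi0 i x y -> phi0 i x z -> y = z).
  { intros x y z. apply ev_functional. }
  assert (A0 : forall k, symcode (lang M k) = G ⟨0, k⟩) by (intros k; exact (fnl _ _ _ (N0 k) (H0 k))).
  assert (A1 : forall x, Nat.b2n (dom M x) = G ⟨1, x⟩)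
    by (intros x; exact (fnl _ _ _ (N1 x) (proj2 (H1 x)))).
  assert (D : forall a, Forall (fun x => dom M x = true) a -> forallb (fun x => sdom G x) a = true).
  { intros a Ha. apply forallb_Forall. revert Ha. apply Forall_impl. intros x Hx.
    unfold sdom. now rewrite <- A1, Hx. }
  split; [exact A0|]. split; [exact A1|]. split.
  - intros k n a E Ha. refine (fnl _ _ _ (N2 k n a E Ha) (proj2 (Hr k (seqcode a) _))).
    unfold rel_tuple. destruct Ha as [<- Ha]. rewrite seqcodeK, D by exact Ha.
    now rewrite <- A0, E, andb_true_r, Nat.eqb_eq.
  - intros k n a E Ha. refine (fnl _ _ _ (N3 k n a E Ha) (proj2 (Hf k (seqcode a) _))).
    unfold fun_tuple. destruct Ha as [<- Ha]. rewrite seqcodeK, D by exact Ha.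
    now rewrite <- A0, E, andb_true_r, Nat.eqb_eq.
Qed.

(** A total function; its values on tuples outside the universe or of the wrong length are whatever
    the record contains, and [names_via] does not look at them. *)
Definition diagram (M : structure) (z : nat) : nat :=
  let p := Cantor.of_nat z in
  let q := Cantor.of_nat (snd p) in
  match fst p with
  | 0 => symcode (lang M (snd p))
  | 1 => Nat.b2n (dom M (snd p))
  | _ => match lang M (fst q) with
         | RelSym _ => Nat.b2n (rel M (fst q) (seqdec (snd q)))
         | _ => fn M (fst q) (seqdec (snd q))
         end
  end.

Lemma agrees_diagram M : agrees M (diagram M).
Proof.
  unfold diagram.
  split; [|split; [|split]]; intros; rewrite !Cantor.cancel_of_to; cbn [fst snd];
    rewrite ?Cantor.cancel_of_to; cbn [fst snd]; rewrite ?H, ?seqcodeK; reflexivity.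
Qed.

Lemma names_via_diagram i M : names_structure i M -> names_via i (diagram M).
Proof.
  intros (N0 & N1 & N2 & N3). pose proof (agrees_diagram M) as HA.
  pose proof HA as (A0 & A1 & A2 & A3).
  split; [|split; [|split; [|split]]].
  - intros k. rewrite <- A0. apply N0.
  - intros x. rewrite <- A1. split; [now destruct (dom M x)|apply N1].
  - destruct (dom_nonempty M) as [x Hx]. exists x. now rewrite <- (agrees_dom M).
  - intros k a Ha. apply (agrees_rel_tuple M _ k a HA) in Ha as (n & E & Ha).
    rewrite <- (seqdecK a), <- (A2 k n _ E Ha).
    split; [now destruct (rel M k (seqdec a))|now apply (N2 k n)].
  - intros k a Ha. apply (agrees_fun_tuple M _ k a HA) in Ha as (n & E & Ha).
    rewrite <- (seqdecK a), <- (A3 k n _ E Ha).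
    split; [|now apply (N3 k n)].
    rewrite <- (agrees_dom M) by exact HA. now apply (fn_closed M k n).
Qed.

(** The total function [f] is cut down to the universe of [M], since the graph of an isomorphism
    contains no other pairs. *)
Lemma iso_via_sound M N G H f f' : agrees M G -> agrees N H -> iso_via G H f f' ->
  isomorphism M N (fun x y => dom M x = true /\ y = f x).
Proof.
  intros HM HN (I0 & I1 & I2 & I3 & I4).
  assert (J1 : forall x, dom M x = true -> dom N (f x) = true /\ f' (f x) = x).
  { intros x. rewrite (agrees_dom M G), (agrees_dom N H) by assumption. intros Hx.
    specialize (I1 x Hx). rewrite andb_true_iff, Nat.eqb_eq in I1. exact I1. }
  assert (J2 : forall y, dom N y = true -> dom M (f' y) = true /\ f (f' y) = y).
  { intros y. rewrite (agrees_dom M G), (agrees_dom N H) by assumption. intros Hy.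
    specialize (I2 y Hy). rewrite andb_true_iff, Nat.eqb_eq in I2. exact I2. }
  assert (L : forall k, lang M k = lang N k).
  { intros k. apply symcode_inj. rewrite (proj1 HM), (proj1 HN). now apply Nat.eqb_eq. }
  assert (tup : forall a b, Forall2 (fun x y => dom M x = true /\ y = f x) a b ->
    b = map (fun x => f x) a /\ tuple_in (dom M) (length a) a /\ tuple_in (dom N) (length a) b).
  { unfold tuple_in. induction 1 as [|x y a b [Hx ->] _ (E & [_ IH1] & [IH2 IH3])]; [easy|].
    destruct (J1 x Hx). cbn [map length]. rewrite IH2, <- E. repeat split; auto. }
  split.
  - exact L.
  - intros x y [Hx ->]. split; [exact Hx|]. now apply J1.
  - intros x Hx. eauto.
  - intros x y y' [_ ->] [_ ->]. reflexivity.
  - intros x x' y [Hx ->] [Hx' E]. rewrite <- (proj2 (J1 x Hx)), E. now apply J1.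
  - intros y Hy. exists (f' y). destruct (J2 y Hy). auto.
  - intros k n a b E <- Hab. apply tup in Hab as (-> & Ha & Hb). apply enc_bool_inj.
    change (Nat.b2n (rel M k a) = Nat.b2n (rel N k (map (fun x => f x) a))).
    rewrite (proj1 (proj2 (proj2 HM)) k _ a E Ha).
    rewrite (proj1 (proj2 (proj2 HN)) k (length a)); [|now rewrite <- L|exact Hb].
    apply Nat.eqb_eq. rewrite <- (seqcodeK a) at 2. apply I3, (agrees_rel_tuple M); [exact HM|].
    rewrite seqcodeK. eauto.
  - intros k n a b E <- Hab. apply tup in Hab as (-> & Ha & Hb).
    split; [now apply (fn_closed M k (length a))|]. symmetry.
    rewrite (proj2 (proj2 (proj2 HM)) k _ a E Ha).
    rewrite (proj2 (proj2 (proj2 HN)) k (length a)); [|now rewrite <- L|exact Hb].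
    apply Nat.eqb_eq. rewrite <- (seqcodeK a) at 2. apply I4, (agrees_fun_tuple M); [exact HM|].
    rewrite seqcodeK. eauto.
Qed.

Lemma iso_via_complete M N F : isomorphism M N F ->
  exists f f', iso_via (diagram M) (diagram N) f f'.
Proof.
  intros [L Fd Ft Ff Fi Fs Fr Fn].
  assert (Hf : forall x, exists y, dom M x = true -> F x y).
  { intros x. destruct (dom M x) eqn:E; [|now exists 0].
    destruct (Ft x E) as [y Hy]. now exists y. }
  assert (Hf' : forall y, exists x, dom N y = true -> F x y).
  { intros y. destruct (dom N y) eqn:E; [|now exists 0].
    destruct (Fs y E) as [x Hx]. now exists x. }
  apply choice in Hf as [f Hf]. apply choice in Hf' as [f' Hf']. exists f, f'.
  pose proof (agrees_diagram M) as HM. pose proof (agrees_diagram N) as HN.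
  assert (tup : forall n a, tuple_in (dom M) n a ->
    Forall2 F a (map (fun x => f x) a) /\ tuple_in (dom N) n (map (fun x => f x) a)).
  { intros n a [<- Ha]. unfold tuple_in. rewrite length_map.
    induction Ha as [|x a Hx _ [IH1 [_ IH2]]]; [easy|]. cbn [map].
    specialize (Hf x Hx). repeat split; constructor; auto. now apply (Fd x). }
  split; [|split; [|split; [|split]]].
  - intros k. apply Nat.eqb_eq. now rewrite <- (proj1 HM), <- (proj1 HN), L.
  - intros x. rewrite <- !(agrees_dom M _ _ HM), <- !(agrees_dom N _ _ HN). intros Hx.
    specialize (Hf x Hx). destruct (Fd _ _ Hf) as [_ Hy]. rewrite Hy. apply Nat.eqb_eq.
    exact (Fi _ _ _ (Hf' _ Hy) Hf).
  - intros y. rewrite <- !(agrees_dom M _ _ HM), <- !(agrees_dom N _ _ HN). intros Hy.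
    specialize (Hf' y Hy). destruct (Fd _ _ Hf') as [Hx _]. rewrite Hx. apply Nat.eqb_eq.
    exact (Ff _ _ _ (Hf _ Hx) Hf').
  - intros k a Ha. apply (agrees_rel_tuple M _ k a HM) in Ha as (n & E & Ha).
    destruct (tup n _ Ha) as [H1 H2]. apply Nat.eqb_eq. rewrite <- (seqdecK a) at 1.
    rewrite <- (proj1 (proj2 (proj2 HM)) k n _ E Ha).
    rewrite <- (proj1 (proj2 (proj2 HN)) k n _ ltac:(now rewrite <- L) H2).
    f_equal. exact (Fr k n _ _ E (proj1 Ha) H1).
  - intros k a Ha. apply (agrees_fun_tuple M _ k a HM) in Ha as (n & E & Ha).
    destruct (tup n _ Ha) as [H1 H2]. apply Nat.eqb_eq. rewrite <- (seqdecK a) at 1.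
    rewrite <- (proj2 (proj2 (proj2 HM)) k n _ E Ha).
    rewrite <- (proj2 (proj2 (proj2 HN)) k n _ ltac:(now rewrite <- L) H2).
    refine (Ff _ _ _ (Hf _ _) (Fn k n _ _ E (proj1 Ha) H1)). now apply (fn_closed M k n).
Qed.

(** Reticence yields some structures named by the indices, not the intended ones; both agree with
    the same diagrams, so the isomorphism carries over. *)
Lemma isomorphic_names i j M N M' N' : names_structure i M -> names_structure j N ->
  names_structure i M' -> names_structure j N' -> isomorphic M N -> isomorphic M' N'.
Proof.
  intros HM HN HM' HN' [F HF]. destruct (iso_via_complete M N F HF) as (f & f' & Hf).
  eexists. refine (iso_via_sound M' N' _ _ f f' _ _ Hf).
  - exact (names_via_agrees i _ _ HM' (names_via_diagram i M HM)).
  - exact (names_via_agrees j _ _ HN' (names_via_diagram j N HN)).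
Qed.

Lemma pi2_names_via : pi2 (fun G i => names_via i G).
Proof. unfold names_via, rel_tuple, fun_tuple, sdom. pi2. Qed.

(** Columns 0 and 1 of [X] hold the two structures, column 2 the isomorphism and column 3 its
    inverse. *)
Definition codes_iso (X : nat -> nat) (n : nat) : Prop :=
  names_via (fst (Cantor.of_nat n)) (fun z => X ⟨0, z⟩) /\
  names_via (snd (Cantor.of_nat n)) (fun z => X ⟨1, z⟩) /\
  iso_via (fun z => X ⟨0, z⟩) (fun z => X ⟨1, z⟩) (fun z => X ⟨2, z⟩) (fun z => X ⟨3, z⟩).

Lemma pi2_codes_iso : pi2 codes_iso.
Proof.
  unfold codes_iso. apply pi2_and; [|apply pi2_and].
  - apply (pi2_subst (fun G n => names_via (fst (Cantor.of_nat n)) G) (fun X _ z => X ⟨0, z⟩));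
      [|eff].
    apply (pi2_comp _ (fun _ n => fst (Cantor.of_nat n)) pi2_names_via). eff.
  - apply (pi2_subst (fun G n => names_via (snd (Cantor.of_nat n)) G) (fun X _ z => X ⟨1, z⟩));
      [|eff].
    apply (pi2_comp _ (fun _ n => snd (Cantor.of_nat n)) pi2_names_via). eff.
  - unfold iso_via, rel_tuple, fun_tuple, sdom. pi2.
Qed.

Lemma codes_iso_exists i j M N : names_structure i M -> names_structure j N ->
  isomorphic M N -> exists X, codes_iso X ⟨i, j⟩.
Proof.
  intros HM HN [F HF]. destruct (iso_via_complete M N F HF) as (f & f' & Hf).
  set (X := fun z => let p := Cantor.of_nat z in
    nth (fst p) [diagram M (snd p); diagram N (snd p); f (snd p); f' (snd p)] 0).
  assert (E : forall k g, (forall z, nth k [diagram M z; diagram N z; f z; f' z] 0 = g z) ->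
    (fun z => X ⟨k, z⟩) = g).
  { intros k g Hg. apply functional_extensionality. intros z. unfold X.
    rewrite Cantor.cancel_of_to. apply Hg. }
  exists X. unfold codes_iso. rewrite !Cantor.cancel_of_to. cbn [fst snd].
  rewrite (E 0 (diagram M)), (E 1 (diagram N)), (E 2 f), (E 3 f') by reflexivity.
  split; [|split]; [now apply names_via_diagram..|exact Hf].
Qed.

(** The function in column 2 is total, but the program must converge only on the universe. So [u]
    first waits until column 0 says that the input belongs to the universe. *)
Lemma isomorphisms_of_enumeration D : (forall A, Sigma11 A -> ce (orc D) A) ->
  exists f, computable_fun2 f /\ finds_isomorphisms D f /\ reticent_isomorphisms D f.
Proof.
  intros HD. destruct (pi2_basis (orc D) HD _ pi2_codes_iso) as [c Hc].
  destruct (ce_uniformize (orc D) (fun p : nat * nat * nat =>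
    ev (orc D) c ⟨fst (fst p), ⟨0, ⟨1, snd (fst p)⟩⟩⟩ 1 /\
    ev (orc D) c ⟨fst (fst p), ⟨2, snd (fst p)⟩⟩ (snd p))) as (u & U1 & U2).
  { rewrite <- (decodeK c). apply ce_and.
    - apply (ce_comp (orc D) _ (fun _ p => ((encode c, ⟨fst (fst p), ⟨0, ⟨1, snd (fst p)⟩⟩⟩), 1))
        (ce_ev (orc D))). eff.
    - apply (ce_comp (orc D) _ (fun _ p => ((encode c, ⟨fst (fst p), ⟨2, snd (fst p)⟩⟩), snd p))
        (ce_ev (orc D))). eff. }
  cbn [fst snd] in *. destruct (smn u) as (g & Hg & Hev).
  exists (fun i j => g ⟨i, j⟩). split; [apply eff2_computable; eff|]. split.
  - intros i j M N HM HN Hiso.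
    destruct (proj1 (Hc ⟨i, j⟩) (codes_iso_exists i j M N HM HN Hiso)) as (X & HX & HcX).
    destruct HX as (V1 & V2 & V3). rewrite Cantor.cancel_of_to in V1, V2. cbn [fst snd] in V1, V2.
    pose proof (names_via_agrees i M _ HM V1) as AM.
    pose proof (names_via_agrees j N _ HN V2) as AN.
    pose proof (iso_via_sound M N _ _ _ _ AM AN V3) as HI.
    assert (E : phi D (g ⟨i, j⟩) = fun x y => dom M x = true /\ y = X ⟨2, x⟩).
    { apply functional_extensionality. intros x. apply functional_extensionality. intros y.
      apply propositional_extensionality. unfold phi. rewrite Hev. split.
      - intros Hy. apply (U1 (⟨i, j⟩, x) y) in Hy as [H1 H2]. cbn [fst snd] in H1, H2.
        rewrite (agrees_dom M _ x AM). unfold sdom. split.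
        + now rewrite (ev_functional _ _ _ _ _ (HcX _) H1).
        + exact (ev_functional _ _ _ _ _ H2 (HcX _)).
      - intros [Hx ->]. rewrite (agrees_dom M _ x AM) in Hx. unfold sdom in Hx.
        apply Nat.eqb_eq in Hx. destruct (U2 (⟨i, j⟩, x)) as [y Hy].
        + exists (X ⟨2, x⟩). cbn [fst snd]. split; [|apply HcX].
          pose proof (HcX ⟨0, ⟨1, x⟩⟩) as H1. now rewrite Hx in H1.
        + destruct (U1 _ _ Hy) as [_ H2]. cbn [fst snd] in H2.
          rewrite (ev_functional _ _ _ _ _ (HcX _) H2). exact Hy. }
    rewrite E. exact HI.
  - intros i j Hn x [y Hy]. apply Hn. apply Hev in Hy.
    apply (U1 (⟨i, j⟩, x) y) in Hy as [H1 _]. cbn [fst snd] in H1.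
    destruct (proj2 (Hc ⟨i, j⟩) _ _ H1) as (X & V1 & V2 & V3).
    rewrite Cantor.cancel_of_to in V1, V2. cbn [fst snd] in V1, V2.
    destruct (names_via_structure i _ V1) as (M & HM & AM).
    destruct (names_via_structure j _ V2) as (N & HN & AN).
    exists M, N. split; [exact HM|]. split; [exact HN|].
    eexists. exact (iso_via_sound M N _ _ _ _ AM AN V3).
Qed.

(** * Trees as isomorphism problems *)

(* Nodes are coded as reversed sequences, so that the parent of a node is the
   tail of its list. *)
Definition parent (j : nat) : nat := snd (Cantor.of_nat (pred j)).

(** The root 0 is excluded because [parent] maps it to 0, which would make it its own child. *)
Definition child (i j : nat) : bool := negb (j =? 0) && (parent j =? i).

Definition child_parity (i y B : nat) : bool :=
  fold_left (fun r j => xorb r (Nat.testbit y j && child i j)) (seq 0 B) false.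

Lemma child_parity_S i y B :
  child_parity i y (S B) = xorb (child_parity i y B) (Nat.testbit y B && child i B).
Proof. unfold child_parity. now rewrite seq_S, fold_left_app. Qed.

Lemma testbit_lt y j : Nat.testbit y j = true -> j < y.
Proof.
  intros H. destruct (Nat.lt_ge_cases j y) as [lt|ge]; [exact lt|].
  rewrite Nat.testbit_eqb, Nat.div_small in H; [discriminate H|].
  apply Nat.le_lt_trans with j; [exact ge|]. apply Nat.pow_gt_lin_r. lia.
Qed.

(** The members of a set written in binary are smaller than its code, so the code itself is a
    sufficient bound. *)
Lemma child_parity_ge i y B : y <= B -> child_parity i y B = child_parity i y y.
Proof.
  intros H. induction H as [|B H IH]; [reflexivity|]. rewrite child_parity_S, IH.
  destruct (Nat.testbit y B) eqn:E; [apply testbit_lt in E; lia|].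
  now rewrite xorb_false_r.
Qed.

Lemma testbit_flip x v i :
  Nat.testbit (Nat.lxor x (2 ^ v)) i = xorb (Nat.testbit x i) (v =? i).
Proof. now rewrite Nat.lxor_spec, Nat.pow2_bits_eqb. Qed.

Lemma child_parity_flip i y v :
  child_parity i (Nat.lxor y (2 ^ v)) (Nat.lxor y (2 ^ v)) = xorb (child_parity i y y) (child i v).
Proof.
  set (y' := Nat.lxor y (2 ^ v)).
  (* A bound common to both sets and above [v], so that the two parities can be compared bit by
     bit. *)
  rewrite <- (child_parity_ge i y' (S v + y + y')), <- (child_parity_ge i y (S v + y + y')) by lia.
  assert (H : forall B, child_parity i y' B = xorb (child_parity i y B) ((v <? B) && child i v)).
  { induction B as [|B IH]; [reflexivity|]. rewrite !child_parity_S, IH. unfold y'.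
    rewrite testbit_flip.
    destruct (Nat.eqb_spec v B) as [->|ne].
    - rewrite Nat.ltb_irrefl, (proj2 (Nat.ltb_lt _ _) (Nat.lt_succ_diag_r B)).
      now destruct (child_parity i y B), (Nat.testbit y B), (child i B).
    - replace (v <? S B) with (v <? B)
        by (destruct (Nat.ltb_spec v B), (Nat.ltb_spec v (S B)); trivial; lia).
      rewrite xorb_false_r.
      now destruct (child_parity i y B), (Nat.testbit y B && _), ((v <? B) && child i v). }
  rewrite H. now rewrite (proj2 (Nat.ltb_lt v (S v + y + y'))) by lia.
Qed.

Lemma child_parity_true i y B : child_parity i y B = true ->
  exists j, Nat.testbit y j = true /\ child i j = true.
Proof.
  induction B as [|B IH]; [discriminate|]. rewrite child_parity_S.
  destruct (child_parity i y B); [auto|]. rewrite xorb_false_l, andb_true_iff. eauto.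
Qed.

Lemma child_true i j : child i j = true <-> exists x, j = S ⟨x, i⟩.
Proof.
  unfold child, parent. rewrite andb_true_iff, negb_true_iff, Nat.eqb_eq, Nat.eqb_neq.
  split.
  - intros [Hj <-]. exists (fst (Cantor.of_nat (pred j))).
    rewrite <- surjective_pairing, Cantor.cancel_to_of. lia.
  - intros [x ->]. split; [lia|]. cbn [pred]. now rewrite Cantor.cancel_of_to.
Qed.

Section TreeStructure.
Variables (T : nat -> list nat -> bool) (n : nat).

Definition node (i l : nat) : bool :=
  (length (seqdec i) =? l) && T n (rev (seqdec i)).

(** The universe consists of the numbers [⟨l, x⟩], where [x] is a finite set of
    numbers in binary.  The relations fix the level [l], the part of [x] outside
    the nodes of level [l] of the tree, and, between adjacent levels, for every
    node the difference between its membership and the parity of the number of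
    its children; [s] says whether the root is marked at level 0. *)
Definition tree_rel (s : bool) (k : nat) (a : list nat) : bool :=
  let p := Cantor.of_nat (nth 0 a 0) in
  let q := Cantor.of_nat (nth 1 a 0) in
  let i := snd (Cantor.of_nat k) in
  let t := fst (Cantor.of_nat k) in
  ite (t =? 0) (fst p =? i)
  (ite (t =? 1) (Nat.testbit (snd p) i && negb (node i (fst p)))
  (ite (t =? 2) ((fst q =? S (fst p)) &&
       Bool.eqb (Nat.testbit (snd p) i) (child_parity i (snd q) (snd q)))
    ((fst p =? 0) && Bool.eqb (Nat.testbit (snd p) 0) s))).

Definition tree_structure (s : bool) : structure :=
  Structure (fun _ => RelSym 2) (fun _ => true) (tree_rel s) (fun _ _ => 0)
    (ex_intro _ 0 eq_refl) (fun _ _ _ _ _ => eq_refl).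

(** The map flips, at level [l], the membership of the node [v l] of the path. Membership of [i]
    changes iff [i] is [v l], and the parity of its children changes iff [v (S l)] is a child of
    [i]; these conditions coincide. At level 0 the flip hits the root and exchanges the two values
    of [s]. *)
Lemma tree_structure_iso X : (forall m, T n (initseg X m) = true) ->
  isomorphic (tree_structure false) (tree_structure true).
Proof.
  intros HX. set (v := fun l => seqcode (rev (initseg X l))).
  assert (Hv : forall l, node (v l) l = true).
  { intros l. unfold node, v. rewrite seqcodeK, length_rev, length_initseg, Nat.eqb_refl.
    rewrite rev_involutive. apply HX. }
  assert (Hc : forall i l, child i (v (S l)) = (v l =? i)).
  { intros i l. unfold v. rewrite initseg_S, rev_app_distr. cbn [rev app seqcode].
    unfold child, parent. cbn [pred]. now rewrite Cantor.cancel_of_to. }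
  set (f := fun z => ⟨fst (Cantor.of_nat z),
    Nat.lxor (snd (Cantor.of_nat z)) (2 ^ v (fst (Cantor.of_nat z)))⟩).
  assert (fK : forall z, f (f z) = z).
  { intros z. unfold f. rewrite Cantor.cancel_of_to. cbn [fst snd].
    rewrite Nat.lxor_assoc, Nat.lxor_nilpotent, Nat.lxor_0_r, <- surjective_pairing.
    apply Cantor.cancel_to_of. }
  exists (fun x y => y = f x). split.
  - reflexivity.
  - easy.
  - eauto.
  - congruence.
  - intros x x' y -> E. rewrite <- (fK x), E. apply fK.
  - intros y _. exists (f y). symmetry. apply fK.
  - intros k m a b E Hm Hab. injection E as <-.
    destruct a as [|z [|w [|]]]; try discriminate Hm.
    inversion Hab as [|? z' ? ? -> Hw]; subst. inversion Hw as [|? w' ? ? -> Hn]; subst.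
    inversion Hn; subst. cbn [tree_structure rel]. unfold tree_rel. cbn [nth].
    unfold f. rewrite !Cantor.cancel_of_to. cbn [fst snd].
    destruct (Cantor.of_nat z) as [l x], (Cantor.of_nat w) as [l' y]. cbn [fst snd].
    destruct (Cantor.of_nat k) as [t i]. cbn [fst snd].
    destruct (t =? 0); cbn [ite]; [reflexivity|].
    destruct (t =? 1); cbn [ite]; [|destruct (t =? 2); cbn [ite]].
    + rewrite testbit_flip. destruct (Nat.eqb_spec (v l) i) as [<-|_].
      * rewrite Hv. now rewrite !andb_false_r.
      * now rewrite xorb_false_r.
    + destruct (Nat.eqb_spec l' (S l)) as [->|_]; [|reflexivity]. cbn [andb].
      rewrite testbit_flip, child_parity_flip, Hc.
      now destruct (Nat.testbit x i), (v l =? i), (child_parity i y y).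
    + destruct (Nat.eqb_spec l 0) as [->|_]; [|reflexivity]. cbn [andb].
      rewrite testbit_flip. change (v 0) with 0. rewrite Nat.eqb_refl.
      now destruct (Nat.testbit x 0).
  - discriminate.
Qed.

(* The images [⟨l, c l⟩] of the empty sets are finite sets of nodes, the root is
   in [c 0], and every node in [c l] has an odd number of children in [c (S l)]. *)
Lemma tree_structure_path : isomorphic (tree_structure false) (tree_structure true) ->
  exists X, forall m, T n (initseg X m) = true.
Proof.
  intros [F [_ _ Ftot _ _ _ Frel _]].
  assert (Hc : forall l, exists c, F ⟨l, 0⟩ ⟨l, c⟩).
  { intros l. destruct (Ftot ⟨l, 0⟩ eq_refl) as [z Hz].
    exists (snd (Cantor.of_nat z)).
    specialize (Frel ⟨0, l⟩ 2 [⟨l, 0⟩; ⟨l, 0⟩] [z; z] eq_refl eq_refl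
      (Forall2_cons _ _ Hz (Forall2_cons _ _ Hz (Forall2_nil F)))).
    cbn [tree_structure rel] in Frel. unfold tree_rel in Frel. cbn [nth] in Frel.
    rewrite !Cantor.cancel_of_to in Frel. cbn [fst snd ite Nat.eqb] in Frel.
    rewrite Nat.eqb_refl in Frel. symmetry in Frel. apply Nat.eqb_eq in Frel.
    rewrite <- Frel at 2. now rewrite <- surjective_pairing, Cantor.cancel_to_of. }
  apply choice in Hc as [c Hc].
  assert (R : forall k l l', tree_rel false k [⟨l, 0⟩; ⟨l', 0⟩] = tree_rel true k [⟨l, c l⟩; ⟨l', c l'⟩]).
  { intros k l l'. apply (Frel k 2); try reflexivity. repeat constructor; apply Hc. }
  unfold tree_rel in R. cbn [nth] in R.
  (* The empty set contains nothing outside the nodes, hence neither does its image. *)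
  assert (Hnode : forall l i, Nat.testbit (c l) i = true -> node i l = true).
  { intros l i Hi. specialize (R ⟨1, i⟩ l l). rewrite !Cantor.cancel_of_to in R.
    cbn [fst snd ite Nat.eqb] in R. rewrite Hi, Nat.bits_0 in R. now destruct (node i l). }
  assert (Hroot : Nat.testbit (c 0) 0 = true).
  { specialize (R ⟨3, 0⟩ 0 0). rewrite !Cantor.cancel_of_to in R.
    cbn [fst snd ite Nat.eqb] in R. rewrite Nat.bits_0 in R. now destruct (Nat.testbit (c 0) 0). }
  (* For empty sets membership and parity agree, so they agree for the images: a member has an odd
     number of children in the next set, hence at least one. *)
  assert (Hchild : forall p, exists x, Nat.testbit (c (fst p)) (snd p) = true ->
    Nat.testbit (c (S (fst p))) (S ⟨x, snd p⟩) = true).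
  { intros [l i]. cbn [fst snd]. destruct (Nat.testbit (c l) i) eqn:Hi; [|now exists 0].
    specialize (R ⟨2, i⟩ l (S l)). rewrite !Cantor.cancel_of_to in R.
    cbn [fst snd ite Nat.eqb] in R. rewrite Nat.eqb_refl, Hi, Nat.bits_0 in R.
    cbn [andb] in R. destruct (child_parity i (c (S l)) (c (S l))) eqn:E; [|discriminate R].
    apply child_parity_true in E as (j & Hj & Hij). apply child_true in Hij as [x ->]. eauto. }
  apply choice in Hchild as [x Hx].
  (* With reversed codes, [S ⟨x, w⟩] is the child of [w] obtained by appending [x]. *)
  set (w := nrec 0 (fun l w => S ⟨x (l, w), w⟩)).
  exists (fun l => x (l, w l)). intros m.
  assert (Hw : forall l, w l = seqcode (rev (initseg (fun l => x (l, w l)) l))).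
  { induction l as [|l IH]; [reflexivity|].
    rewrite initseg_S, rev_app_distr. cbn [rev app seqcode]. now rewrite <- IH. }
  assert (Hb : forall l, Nat.testbit (c l) (w l) = true).
  { induction l as [|l IH]; [exact Hroot|]. exact (Hx (l, w l) IH). }
  specialize (Hnode m (w m) (Hb m)). unfold node in Hnode.
  rewrite (Hw m), seqcodeK, rev_involutive in Hnode. now apply andb_prop in Hnode.
Qed.
End TreeStructure.

Lemma tree_structure_index T s : eff2 T ->
  exists g, eff1 g /\ forall n, names_structure (g n) (tree_structure T n s).
Proof.
  intros HT.
  destruct (index_total (fun n z =>
    let q := Cantor.of_nat (snd (Cantor.of_nat z)) in
    ite (fst (Cantor.of_nat z) =? 0) (symcode (RelSym 2))
    (ite (fst (Cantor.of_nat z) =? 1) 1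
       (Nat.b2n (tree_rel T n s (fst q) (seqdec (snd q))))))) as (g & Hg & H).
  { unfold tree_rel, node, child_parity, child, parent. eff. }
  exists g. split; [exact Hg|]. intros n. split; [|split; [|split]].
  - intros k. specialize (H n ⟨0, k⟩). now rewrite !Cantor.cancel_of_to in H.
  - intros x. specialize (H n ⟨1, x⟩). now rewrite !Cantor.cancel_of_to in H.
  - intros k m a _ _. specialize (H n ⟨2, ⟨k, seqcode a⟩⟩). cbv zeta in H.
    rewrite !Cantor.cancel_of_to in H. cbn [fst snd ite Nat.eqb] in H.
    rewrite !Cantor.cancel_of_to in H. cbn [fst snd] in H. now rewrite seqcodeK in H.
  - discriminate.
Qed.

Lemma enumeration_of_isomorphisms D f A : computable_fun2 f -> finds_isomorphisms D f ->
  reticent_isomorphisms D f -> Sigma11 A -> ce (orc D) A.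
Proof.
  intros Hf Hd Hr HA. apply Sigma11_eff in HA as (T & HT & HA).
  destruct (tree_structure_index T false HT) as (g & Hg & Hn).
  destruct (tree_structure_index T true HT) as (g' & Hg' & Hn').
  apply eff2_computable in Hf.
  apply (ce_iff _ (fun n => exists x y, phi D (f (g n) (g' n)) x y /\ true = true)).
  2: { apply (ce_phi_values D (fun n => f (g n) (g' n)) (fun _ => true)); eff. }
  intros n. rewrite HA. split.
  - intros (x & y & Hy & _). apply NNPP. intros H.
    apply (Hr (g n) (g' n)) with (n := x); [|now exists y].
    intros (M & N & HM & HN & Hiso). apply H, tree_structure_path.
    exact (isomorphic_names _ _ _ _ _ _ HM HN (Hn n) (Hn' n) Hiso).
  - intros [X HX].
    destruct (iso_total _ _ _ (Hd _ _ _ _ (Hn n) (Hn' n) (tree_structure_iso T n X HX)) 0 eq_refl)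
      as [y Hy]. exists 0, y. auto.
Qed.

Theorem mainTheorem18 (d : (nat -> bool) -> Prop) (hd : turing_degree d) :
  (enumerates_all_Sigma11 d <-> unif_high_paths_reticent d) /\
  (enumerates_all_Sigma11 d <-> unif_high_isomorphism_reticent d) /\
  (enumerates_all_Sigma11 d <-> unif_high_descending_reticent d) /\
  (enumerates_all_Sigma11 d <-> unif_high_tight_descending d) /\
  (enumerates_all_Sigma11 d <-> unif_high_tight_descending_reticent d).
Proof.
  assert (weaken : forall D f, finds_tight_descending D f -> finds_descending D f).
  { intros D f H e L HL Hi. destruct (H e L HL Hi) as (g & Hg & Hd & _). eauto. }
  rewrite (enumerates_oracle d hd). repeat split.
  - intros (D & HD & H). destruct (paths_of_enumeration D H) as (f & ? & ? & ?).
    exists D, f. auto.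
  - intros (D & f & HD & Hf & H1 & H2). exists D. split; [exact HD|]. intros A.
    now apply (enumeration_of_paths D f).
  - intros (D & HD & H). destruct (isomorphisms_of_enumeration D H) as (f & ? & ? & ?).
    exists D, f. auto.
  - intros (D & f & HD & Hf & H1 & H2). exists D. split; [exact HD|]. intros A.
    now apply (enumeration_of_isomorphisms D f).
  (* Descending sequences are obtained from the stronger tight ones through [weaken]; the reticence
     condition is the same for both. *)
  - intros (D & HD & H). destruct (tight_of_enumeration D H) as (f & ? & ? & ?).
    exists D, f. auto.
  - intros (D & f & HD & Hf & H1 & H2). exists D. split; [exact HD|]. intros A.
    now apply (enumeration_of_descending D f).
  - intros (D & HD & H). destruct (tight_of_enumeration D H) as (f & ? & ? & ?).
    exists D, f. auto.
  - intros (D & f & HD & Hf & H1). exists D. split; [exact HD|]. intros A.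
    now apply (enumeration_of_tight D f).
  - intros (D & HD & H). destruct (tight_of_enumeration D H) as (f & ? & ? & ?).
    exists D, f. auto.
  - intros (D & f & HD & Hf & H1 & _). exists D. split; [exact HD|]. intros A.
    now apply (enumeration_of_tight D f).
Qed.
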